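(* Consider the problem data, the reformulated problem (R), and the IPLUX iterates $\mathbf{y}(k),\mathbf{v}(k),\mathbf{u}(k),\mathbf{z}(k),\mathbf{q}(k)$ described in the context, with parameters $\gamma,\lambda,\rho>0$ and $\alpha=\alpha_1+\alpha_2+\alpha_3$, $\alpha_1,\alpha_2,\alpha_3>0$. Suppose the matrices $P^W,P^H\in\mathbb{R}^{n\times n}$ satisfy: (i) $[P^W]_{ij}=[P^H]_{ij}=0$ for all $i\in\mathcal{V}$, $j\notin\mathcal{N}_i\cup\{i\}$; (ii) $P^W$ and $P^H$ are symmetric positive semidefinite; (iii) $P^W\mathbf{1}_n=\mathbf{1}_n$ and $\operatorname{Null}(P^H)=\operatorname{span}(\mathbf{1}_n)$; (iv) $P^W+P^H\preceq I_n$. Suppose further that problem (P) satisfies: (a) each $f_i$ and $h_i$, $i\in\mathcal{V}$, is convex on $\operatorname{dom}(h_i)$, and $\operatorname{dom}(h_i)$ is convex; (b) each $f_i$ is differentiable on $\operatorname{dom}(h_i)$ and $\nabla f_i$ is Lipschitz continuous with constant $L_f>0$ on $\operatorname{dom}(h_i)$; (c) each $g_i$, $i\in\mathcal{V}$, is convex (entrywise) and Lipschitz continuous with constant $L_g>0$ on $\operatorname{dom}(h_i)$; (d) each $g_{ij}^s$, $i\in\mathcal{V}^{\mathrm{in}}$, $j\in S_i^{\mathrm{in}}$, is convex (entrywise) and Lipschitz continuous with constant $L_{g^s}>0$ on $\operatorname{dom}(h_j)$; (e) problem (P) has at least one optimal solution; (f) there exist $\tilde{x}_i$ in the relative interior of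 $\operatorname{dom}(h_i)$, $i\in\mathcal{V}$, such that $\sum_{i\in\mathcal{V}}g_i(\tilde{x}_i)<\mathbf{0}$, $\sum_{i\in\mathcal{V}}A_i\tilde{x}_i=\sum_{i\in\mathcal{V}}b_i$, $\sum_{j\in S_i^{\mathrm{in}}}g_{ij}^s(\tilde{x}_j)<\mathbf{0}$ for all $i\in\mathcal{V}^{\mathrm{in}}$, and $\sum_{j\in S_i^{\mathrm{eq}}}A_{ij}^s\tilde{x}_j=b_i^s$ for all $i\in\mathcal{V}^{\mathrm{eq}}$. Let $L=\Bigl(\bigl(\max_{i\in\mathcal{V}}\sum_{j\in\mathcal{V}^{\mathrm{in}}:\,i\in S_j^{\mathrm{in}}}|S_j^{\mathrm{in}}|\bigr)L_{g^s}^2+1+L_g^2\Bigr)^{1/2}$ and suppose $\alpha\ge L_f+L^2$ and $\lambda\ge\|\mathbf{B}^s\|_2$. Let $\mathbf{y}^\star$ be an optimal solution of (R), let $\mathbf{z}^\star=\mathbf{B}\mathbf{y}^\star-\mathbf{c}$, let $(\mathbf{q}^\star,u^\star,\tilde{\mathbf{v}}^\star)$ be a geometric multiplier for (R), and let $\bar{\mathbf{y}}(k)=\frac1k\sum_{\ell=1}^k\mathbf{y}(\ell)$. Then for every $k\ge1$, $$\mathbf{G}(\bar{\mathbf{y}}(k))\le\frac{V_{\mathbf{q}}}{k}\mathbf{1},$$ $$\|(\mathbf{1}_n\otimes I_{\tilde m+\tilde p})^T(\mathbf{B}\bar{\mathbf{y}}(k)-\mathbf{c})\|\le\frac{\rho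 V_{\mathbf{u}}}{k},$$ $$\|\mathbf{B}^s\bar{\mathbf{y}}(k)-\mathbf{c}^s\|\le\frac{V_{\mathbf{v}}}{\gamma k},$$ $$-\frac{R_\Phi}{k}\le\Phi(\bar{\mathbf{y}}(k))-\Phi(\mathbf{y}^\star)\le\frac{R_\Phi'}{k},$$ where $V_{\mathbf{q}},V_{\mathbf{u}},V_{\mathbf{v}},R_\Phi,R_\Phi'\in[0,\infty)$ are given, with $M^\dag:=((\mathbf{B}^s)^T\mathbf{B}^s)^\dag$, by $$V_{\mathbf{q}}=2(\|\mathbf{q}^\star\|+\sqrt{C}),\qquad V_{\mathbf{u}}=\sqrt n\,\bigl(\|\mathbf{u}(0)\|_W+\sqrt n\|u^\star\|+\sqrt{2C/\rho}\bigr),$$ $$V_{\mathbf{v}}=\|\mathbf{v}(0)\|_{M^\dag}+\|\tilde{\mathbf{v}}^\star\|+\sqrt{2\gamma C},\qquad R_\Phi=V_{\mathbf{q}}\mathbf{1}^T\mathbf{q}^\star+\rho V_{\mathbf{u}}\|u^\star\|+V_{\mathbf{v}}\|\tilde{\mathbf{v}}^\star\|/\gamma,\qquad R_\Phi'=R(0),$$ $$C=R(0)+\rho\sqrt n\|u^\star\|\,\|\mathbf{u}(0)\|_W+\frac1\gamma\|\tilde{\mathbf{v}}^\star\|\,\|\mathbf{v}(0)\|_{M^\dag}+\frac{\rho n}{2}\|u^\star\|^2+\frac{1}{2\gamma}\|\tilde{\mathbf{v}}^\star\|^2+\|\mathbf{q}^\star\|^2+\frac12\|\mathbf{G}(\mathbf{y}^\star)\|^2,$$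 $$R(0)=\frac{1}{2\rho}\|\mathbf{z}(0)-\mathbf{z}^\star\|_{H^\dag}^2+\frac\rho2\|\mathbf{u}(0)\|_W^2+\frac{1}{2\gamma}\|\mathbf{v}(0)\|_{M^\dag}^2+\frac{\gamma\lambda^2+\alpha}{2}\|\mathbf{y}(0)-\mathbf{y}^\star\|^2+\frac12\|\mathbf{q}(0)\|^2-\frac12\|\mathbf{G}(\mathbf{y}(0))\|^2.$$
   Context: Notation: $\|\cdot\|$ is the Euclidean norm, $\|\cdot\|_2$ the spectral norm; for symmetric positive semidefinite $A$, $A^\dag$ is its Moore-Penrose inverse and $\|x\|_A=\sqrt{x^TAx}$. Vector inequalities and $\max$ of vectors are entrywise. $\mathbf{1}$ is the all-one vector (of proper dimension), $\operatorname{diag}$ denotes block diagonal matrices, $\operatorname{dom}(h)=\{x: h(x)<+\infty\}$. Problem (P). Let $\mathcal{V}=\{1,\dots,n\}$, $x_i\in\mathbb{R}^{d_i}$: $$\min_{x_i,\,i\in\mathcal{V}}\ \sum_{i\in\mathcal{V}}(f_i(x_i)+h_i(x_i))\ \text{ s.t. }\ \sum_{i\in\mathcal{V}}g_i(x_i)\le\mathbf{0}_{\tilde p},\ \ \sum_{i\in\mathcal{V}}A_ix_i=\sum_{i\in\mathcal{V}}b_i,\ \ \sum_{j\in S_i^{\mathrm{in}}}g_{ij}^s(x_j)\le\mathbf{0}_{p_i}\ \forall i\in\mathcal{V}^{\mathrm{in}},\ \ \sum_{j\in S_i^{\mathrm{eq}}}A_{ij}^sx_j=b_i^s\ \forall i\in\mathcal{V}^{\mathrm{eq}}.$$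 Here $f_i:\mathbb{R}^{d_i}\to\mathbb{R}$, $h_i:\mathbb{R}^{d_i}\to\mathbb{R}\cup\{+\infty\}$, $g_i:\mathbb{R}^{d_i}\to\mathbb{R}^{\tilde p}$, $A_i\in\mathbb{R}^{\tilde m\times d_i}$, $b_i\in\mathbb{R}^{\tilde m}$, $g_{ij}^s:\mathbb{R}^{d_j}\to\mathbb{R}^{p_i}$, $A_{ij}^s\in\mathbb{R}^{m_i\times d_j}$, $b_i^s\in\mathbb{R}^{m_i}$; $\mathcal{V}^{\mathrm{in}},\mathcal{V}^{\mathrm{eq}}\subseteq\mathcal{V}$ (possibly empty), $S_i^{\mathrm{in}},S_i^{\mathrm{eq}}$ are proper subsets of $\mathcal{V}$, with $S_i^{\mathrm{in}}=\emptyset$ for $i\notin\mathcal{V}^{\mathrm{in}}$ and $S_i^{\mathrm{eq}}=\emptyset$ for $i\notin\mathcal{V}^{\mathrm{eq}}$. $\tilde p,\tilde m$ may be $0$ (the corresponding constraints are then absent); at least one constraint is present. Graph. For $i\in\mathcal{V}$ let $\mathcal{N}_i^s=\{j\in\mathcal{V}\setminus\{i\}: j\in S_i^{\mathrm{in}}\cup S_i^{\mathrm{eq}}\text{ or }i\in S_j^{\mathrm{in}}\cup S_j^{\mathrm{eq}}\}$ and $\mathcal{E}^s=\{\{i,j\}: i\in\mathcal{V},j\in\mathcal{N}_i^s\}$. $\mathcal{G}=(\mathcal{V},\mathcal{E})$ is an undirected graph: if $\mathcal{V}^{\mathrm{in}}=\mathcal{V}^{\mathrm{eq}}=\emptyset$,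 any connected graph; if $\tilde m=\tilde p=0$, $\mathcal{E}=\mathcal{E}^s$; otherwise $\mathcal{E}=\mathcal{E}^s$ if $(\mathcal{V},\mathcal{E}^s)$ is connected, else $\mathcal{E}$ is $\mathcal{E}^s$ plus added links making the graph connected. $\mathcal{N}_i=\{j:\{i,j\}\in\mathcal{E}\}$. Reformulated problem (R). Let $y_i=[x_i^T,t_i^T]^T\in\mathbb{R}^{d_i+\tilde p}$, $\mathbf{y}=[y_1^T,\dots,y_n^T]^T\in\mathbb{R}^N$, $N=n\tilde p+\sum_id_i$; $f(\mathbf{y})=\sum_if_i(x_i)$, $h(\mathbf{y})=\sum_ih_i(x_i)$, $\Phi=f+h$. $G_i(\mathbf{y})$ is $g_i(x_i)-t_i$ stacked over $\sum_{j\in S_i^{\mathrm{in}}}g_{ij}^s(x_j)$ if $i\in\mathcal{V}^{\mathrm{in}}$, and $G_i(\mathbf{y})=g_i(x_i)-t_i$ otherwise; $\mathbf{G}(\mathbf{y})=[G_1(\mathbf{y})^T,\dots,G_n(\mathbf{y})^T]^T\in\mathbb{R}^{n\tilde p+\sum_{i\in\mathcal{V}^{\mathrm{in}}}p_i}$. $B_i=\operatorname{diag}(A_i,I_{\tilde p})$, $c_i=[b_i^T,\mathbf{0}_{\tilde p}^T]^T$, $\mathbf{B}=\operatorname{diag}(B_1,\dots,B_n)$, $\mathbf{c}=[c_1^T,\dots,c_n^T]^T$. For $i\in\mathcal{V}^{\mathrm{eq}}$, $B_i^s=[B_{i1}^s,\dots,B_{in}^s]$ with $B_{ij}^s=[A_{ij}^s,\mathbf{O}_{m_i\times\tilde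 p}]$ if $j\in S_i^{\mathrm{eq}}$ and $B_{ij}^s=\mathbf{O}$ otherwise; $\mathbf{B}^s,\mathbf{c}^s$ are obtained by vertically stacking $B_i^s$, $b_i^s$ over $i\in\mathcal{V}^{\mathrm{eq}}$. Problem (R) is $$\min_{\mathbf{y}\in\mathbb{R}^N}\Phi(\mathbf{y})\ \text{ s.t. }\ \mathbf{G}(\mathbf{y})\le\mathbf{0},\ \ (\mathbf{1}_n\otimes I_{\tilde m+\tilde p})^T(\mathbf{B}\mathbf{y}-\mathbf{c})=\mathbf{0},\ \ \mathbf{B}^s\mathbf{y}=\mathbf{c}^s.$$ A geometric multiplier for (R) is a triple $(\mathbf{q}^\star,u^\star,\tilde{\mathbf{v}}^\star)$ with $\mathbf{q}^\star\ge\mathbf{0}$, $u^\star\in\mathbb{R}^{\tilde m+\tilde p}$, $\tilde{\mathbf{v}}^\star\in\mathbb{R}^{\sum_{i\in\mathcal{V}^{\mathrm{eq}}}m_i}$ such that $\Phi(\mathbf{y}^\star)=\min_{\mathbf{y}\in\mathbb{R}^N}\Phi(\mathbf{y})+\langle\mathbf{q}^\star,\mathbf{G}(\mathbf{y})\rangle+\langle u^\star,(\mathbf{1}_n\otimes I_{\tilde m+\tilde p})^T(\mathbf{B}\mathbf{y}-\mathbf{c})\rangle+\langle\tilde{\mathbf{v}}^\star,\mathbf{B}^s\mathbf{y}-\mathbf{c}^s\rangle$, where $\mathbf{y}^\star$ is an optimal solution of (R). IPLUX. Let $W=P^W\otimes I_{\tilde m+\tilde p}$, $H=P^H\otimes I_{\tilde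 m+\tilde p}$. Initialize with arbitrary $\mathbf{y}(0)\in\operatorname{dom}(h)$, arbitrary $\mathbf{u}(0)\in\mathbb{R}^{n(\tilde m+\tilde p)}$, $\mathbf{v}(0)\in\operatorname{Range}((\mathbf{B}^s)^T)$, $\mathbf{z}(0)=\rho H\mathbf{u}(0)$, $\mathbf{q}(0)=\max\{-\mathbf{G}(\mathbf{y}(0)),\mathbf{0}\}$. For each $k\ge0$: $\mathbf{y}(k+1)=\arg\min_{\mathbf{y}\in\mathbb{R}^N}\mathcal{L}^k(\mathbf{y})$, where $\mathcal{L}^k(\mathbf{y})=\langle\nabla f(\mathbf{y}(k)),\mathbf{y}-\mathbf{y}(k)\rangle+h(\mathbf{y})+\langle\mathbf{v}(k),\mathbf{y}\rangle+\frac{\gamma\lambda^2}{2}\|\mathbf{y}-\mathbf{y}(k)+\frac1{\lambda^2}(\mathbf{B}^s)^T(\mathbf{B}^s\mathbf{y}(k)-\mathbf{c}^s)\|^2+\frac1{2\rho}\|\mathbf{B}\mathbf{y}-\mathbf{c}\|^2+\langle W\mathbf{u}(k)-\frac1\rho\mathbf{z}(k),\mathbf{B}\mathbf{y}-\mathbf{c}\rangle+\langle\mathbf{q}(k)+\mathbf{G}(\mathbf{y}(k)),\mathbf{G}(\mathbf{y})\rangle+\frac{\alpha}{2}\|\mathbf{y}-\mathbf{y}(k)\|^2$; $\mathbf{v}(k+1)=\mathbf{v}(k)+\gamma(\mathbf{B}^s)^T(\mathbf{B}^s\mathbf{y}(k+1)-\mathbf{c}^s)$; $\mathbf{u}(k+1)=W\mathbf{u}(k)+\frac1\rho(\mathbf{B}\mathbf{y}(k+1)-\mathbf{c}-\mathbf{z}(k))$;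 $\mathbf{z}(k+1)=\mathbf{z}(k)+\rho H\mathbf{u}(k+1)$; $\mathbf{q}(k+1)=\max\{-\mathbf{G}(\mathbf{y}(k+1)),\mathbf{q}(k)+\mathbf{G}(\mathbf{y}(k+1))\}$. *)

(* Defs.v *)
From HB Require Import structures.
From mathcomp Require Import all_boot all_order all_algebra.
From mathcomp Require Import all_classical all_reals all_analysis.

Set Implicit Arguments.
Unset Strict Implicit.
Unset Printing Implicit Defensive.

Import Order.TTheory GRing.Theory Num.Theory.
Import numFieldNormedType.Exports.

Local Open Scope classical_set_scope.
Local Open Scope ring_scope.

Section LinearAlgebra.
Context {R : realType}.

Definition dotv m (x y : 'cV[R]_m) : R := (x^T *m y) 0 0.

(* The library norm on matrices is the sup norm, hence this separate Euclidean
   norm. *)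
Definition enorm m (x : 'cV[R]_m) : R := Num.sqrt (dotv x x).

Definition wnorm m (A : 'M[R]_m) (x : 'cV[R]_m) : R :=
  Num.sqrt (dotv x (A *m x)).

Definition spectral_norm m n (A : 'M[R]_(m, n)) : R :=
  sup [set enorm (A *m x) | x in [set x : 'cV[R]_n | enorm x <= 1]].

Definition psdmx m (A : 'M[R]_m) : Prop :=
  A^T = A /\ forall x : 'cV[R]_m, 0 <= dotv x (A *m x).

Definition lev m (x y : 'cV[R]_m) : Prop := forall r, x r 0 <= y r 0.
Definition ltv m (x y : 'cV[R]_m) : Prop := forall r, x r 0 < y r 0.
Definition maxv m (x y : 'cV[R]_m) : 'cV[R]_m := map2_mx Num.max x y.

Definition moore_penrose m n (A : 'M[R]_(m, n)) (X : 'M[R]_(n, m)) : Prop :=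
  [/\ A *m X *m A = A, X *m A *m X = X,
      (A *m X)^T = A *m X & (X *m A)^T = X *m A].

(* The default value 0 is never taken, see mpinvP. *)
Definition mpinv m n (A : 'M[R]_(m, n)) : 'M[R]_(n, m) :=
  xget 0 [set X | moore_penrose A X].

Lemma dotvv_eq0 m (x : 'cV[R]_m) : dotv x x = 0 -> x = 0.
Proof.
rewrite /dotv mxE => /eqP; rewrite psumr_eq0 => [/allP x0|j _]; last first.
  by rewrite mxE -expr2 sqr_ge0.
apply/matrixP => i j; rewrite ord1 [RHS]mxE; apply/eqP.
have := x0 i (mem_index_enum _); rewrite mxE -expr2 sqrf_eq0.
by [].
Qed.

Lemma row_free_gram_unit m n (A : 'M[R]_(m, n)) :
  row_free A -> A *m A^T \in unitmx.
Proof.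
move=> Afree; rewrite -row_free_unit -kermx_eq0; apply/eqP/row_matrixP => i.
rewrite row0; set u := row i _.
have uAA : u *m (A *m A^T) = 0 by rewrite -row_mul mulmx_ker row0.
have uA : (u *m A)^T = 0.
  apply: dotvv_eq0; rewrite /dotv trmxK trmx_mul !mulmxA -(mulmxA u) uAA.
  by rewrite mul0mx mxE.
have uA0 : u *m A = 0 by rewrite -[LHS]trmxK uA trmx0.
by apply: (row_free_inj Afree); rewrite uA0 mul0mx.
Qed.

Lemma moore_penrose_exists m n (A : 'M[R]_(m, n)) :
  exists X, moore_penrose A X.
Proof.
rewrite -[A]mulmx_base.
have := row_free_gram_unit (row_base_free A).
have : (col_base A)^T *m col_base A \in unitmx.
  rewrite -{2}[col_base A]trmxK; apply: row_free_gram_unit.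
  by rewrite /row_free mxrank_tr; exact: col_base_full.
move: (col_base A) (row_base A) => C F CU FU.
set B := C *m F; pose P := invmx (F *m F^T); pose Q := invmx (C^T *m C).
have BX : B *m (F^T *m P *m Q *m C^T) = C *m Q *m C^T.
  rewrite /B !mulmxA -(mulmxA C F) -(mulmxA C _ P) mulmxV //.
  by rewrite mulmx1.
have XB : (F^T *m P *m Q *m C^T) *m B = F^T *m P *m F.
  rewrite /B !mulmxA -(mulmxA _ C^T C) -(mulmxA _ Q (C^T *m C)) mulVmx //.
  by rewrite mulmx1.
exists (F^T *m P *m Q *m C^T); split.
- rewrite BX /B !mulmxA -(mulmxA _ C^T C) -(mulmxA _ Q (C^T *m C)) mulVmx //.
  by rewrite mulmx1.
- rewrite XB !mulmxA -(mulmxA _ F F^T) -(mulmxA _ P (F *m F^T)) mulVmx //.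
  by rewrite mulmx1.
- by rewrite BX !trmx_mul trmxK trmx_inv trmx_mul trmxK mulmxA.
- by rewrite XB !trmx_mul trmxK trmx_inv trmx_mul trmxK mulmxA.
Qed.

Lemma mpinvP m n (A : 'M[R]_(m, n)) : moore_penrose A (mpinv A).
Proof. exact: (xgetPex (0 : 'M[R]_(n, m)) (moore_penrose_exists A)). Qed.

Lemma moore_penrose_uniq m n (A : 'M[R]_(m, n)) X Y :
  moore_penrose A X -> moore_penrose A Y -> X = Y.
Proof.
move=> [aX xX sX tX] [aY yY sY tY].
have e1 : A *m X = A *m Y.
  by rewrite -sX -{1}aY -mulmxA trmx_mul sX sY mulmxA aX.
have e2 : X *m A = Y *m A.
  by rewrite -tX -{1}aY -mulmxA mulmxA trmx_mul tX tY -mulmxA (mulmxA A) aX.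
by rewrite -xX e2 -mulmxA e1 mulmxA yY.
Qed.

(* P \otimes I_r *)
Definition kron_id m n (P : 'M[R]_(m, n)) (r : nat) :
    'M[R]_(\sum_(i < m) r, \sum_(j < n) r) :=
  mxblock (p_ := fun=> r) (q_ := fun=> r) (fun i j => (P i j)%:M).

(* 1_n \otimes I_r *)
Definition ones_kron_id (n r : nat) : 'M[R]_(\sum_(i < n) r, r) :=
  mxcol (p_ := fun=> r) (fun _ : 'I_n => 1%:M).

(* M if b, and the matrix without rows otherwise: \mxcol_i (rows_if (i \in V) _)
   is the vertical stack over the indices in V only. *)
Definition rows_if (b : bool) a k (M : 'M[R]_(a, k)) :
    'M[R]_(if b then a else 0%N, k) :=
  if b return 'M[R]_(if b then a else 0%N, k) then M else 0.

End LinearAlgebra.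

Section Analysis.
Context {R : realType}.

Definition edom T (h : T -> \bar R) : set T := [set x | (h x < +oo)%E].

Definition grad d (f : 'cV[R]_d -> R) (x : 'cV[R]_d) : 'cV[R]_d :=
  \col_j 'D_(delta_mx j 0) f x.

Definition lipschitz_with a b (D : set 'cV[R]_a) (L : R)
    (g : 'cV[R]_a -> 'cV[R]_b) : Prop :=
  forall x y, D x -> D y -> enorm (g x - g y) <= L * enorm (x - y).

Definition convex_entrywise a b (D : set 'cV[R]_a)
    (g : 'cV[R]_a -> 'cV[R]_b) : Prop :=
  forall r, convex_function D (fun x => g x r 0).

Definition affine_hull d (D : set 'cV[R]_d) : set 'cV[R]_d :=
  [set x | exists (k : nat) (a : 'I_k -> R) (z : 'I_k -> 'cV[R]_d),
     [/\ forall l, D (z l), \sum_l a l = 1 & x = \sum_l a l *: z l]].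

Definition relint d (D : set 'cV[R]_d) : set 'cV[R]_d :=
  [set x | D x /\ exists2 e : R, 0 < e &
     forall y, affine_hull D y -> enorm (y - x) < e -> D y].

Definition is_argmin T (F : T -> \bar R) (x : T) : Prop :=
  forall y, (F x <= F y)%E.

Definition is_min_value T (F : T -> \bar R) (v : \bar R) : Prop :=
  (exists y, F y = v) /\ forall y, (v <= F y)%E.

Definition optimal T (feas : set T) (F : T -> \bar R) (x : T) : Prop :=
  feas x /\ forall y, feas y -> (F x <= F y)%E.

End Analysis.

(* Nodes are numbered from 0; xdim, pt, mt stand for d_i and the numbers of
   coupling inequalities and equalities (either of which may be 0).  A value
   +oo of h_ i encodes points outside its domain.  The data gs i, As i, bs i,
   pdim i, mdim i of the sparse constraints are only meaningful for i \in Vin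
   (resp. i \in Veq); their values elsewhere are never used. *)
Record problem (R : realType) (n : nat) := Problem {
  xdim : 'I_n -> nat;
  pt : nat;
  mt : nat;
  f_ : forall i, 'cV[R]_(xdim i) -> R;
  h_ : forall i, 'cV[R]_(xdim i) -> \bar R;
  g_ : forall i, 'cV[R]_(xdim i) -> 'cV[R]_pt;
  A_ : forall i, 'M[R]_(mt, xdim i);
  b_ : 'I_n -> 'cV[R]_mt;
  Vin : {set 'I_n};
  Veq : {set 'I_n};
  Sin : 'I_n -> {set 'I_n};
  Seq : 'I_n -> {set 'I_n};
  pdim : 'I_n -> nat;
  mdim : 'I_n -> nat;
  gs : forall i j, 'cV[R]_(xdim j) -> 'cV[R]_(pdim i);
  As : forall i j, 'M[R]_(mdim i, xdim j);
  bs : forall i, 'cV[R]_(mdim i)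
}.

Arguments f_ {R n} p i _.
Arguments h_ {R n} p i _.
Arguments g_ {R n} p i _.
Arguments A_ {R n} p i.
Arguments b_ {R n} p i.
Arguments gs {R n} p i j _.
Arguments As {R n} p i j.
Arguments bs {R n} p i.

Section Problem.
Context {R : realType} {n : nat}.
Variable P : problem R n.

Notation d := (xdim P).
Notation r := (mt P + pt P)%N.
Notation p := (pt P).

Record problem_wf : Prop := ProblemWf {
  wf_n : (0 < n)%N;
  wf_h : forall i x, h_ P i x <> -oo%E;
  wf_Sin_proper : forall i, Sin P i \proper (finset.setTfor 'I_n);
  wf_Seq_proper : forall i, Seq P i \proper (finset.setTfor 'I_n);
  wf_Sin0 : forall i, i \notin Vin P -> Sin P i = finset.set0;
  wf_Seq0 : forall i, i \notin Veq P -> Seq P i = finset.set0;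
  wf_constrained : [|| 0 < pt P, 0 < mt P, Vin P != finset.set0
                     | Veq P != finset.set0]%N
}.

Notation xvec := (forall i, 'cV[R]_(d i)).

Definition P_objective (x : xvec) : \bar R :=
  (\sum_(i < n) ((f_ P i (x i))%:E + h_ P i (x i)))%E.

Definition P_feasible (x : xvec) : Prop :=
  [/\ lev (\sum_(i < n) g_ P i (x i)) 0,
      \sum_(i < n) A_ P i *m x i = \sum_(i < n) b_ P i,
      forall i, i \in Vin P -> lev (\sum_(j in Sin P i) gs P i j (x j)) 0 &
      forall i, i \in Veq P -> \sum_(j in Seq P i) As P i j *m x j = bs P i].

Definition P_optimal : xvec -> Prop := optimal P_feasible P_objective.

Definition slater : Prop := exists x : xvec,
  (forall i, relint (edom (h_ P i)) (x i)) /\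
  [/\ ltv (\sum_(i < n) g_ P i (x i)) 0,
      \sum_(i < n) A_ P i *m x i = \sum_(i < n) b_ P i,
      forall i, i \in Vin P -> ltv (\sum_(j in Sin P i) gs P i j (x j)) 0 &
      forall i, i \in Veq P -> \sum_(j in Seq P i) As P i j *m x j = bs P i].

Record problem_assumption (Lf Lg Lgs : R) : Prop := ProblemAssumption {
  as_f_convex : forall i, convex_function (edom (h_ P i)) (f_ P i);
  (* h_i is finite on its domain, where it coincides with fine \o h_i *)
  as_h_convex : forall i,
    convex_function (edom (h_ P i)) (fun x => fine (h_ P i x));
  as_dom_convex : forall i, convex_set (edom (h_ P i));
  as_f_diff : forall i x,
    edom (h_ P i) x -> differentiable (f_ P i) x;
  as_f_smooth : forall i,
    lipschitz_with (edom (h_ P i)) Lf (grad (f_ P i));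
  as_g_convex : forall i, convex_entrywise (edom (h_ P i)) (g_ P i);
  as_g_lip : forall i, lipschitz_with (edom (h_ P i)) Lg (g_ P i);
  as_gs_convex : forall i j, i \in Vin P -> j \in Sin P i ->
    convex_entrywise (edom (h_ P j)) (gs P i j);
  as_gs_lip : forall i j, i \in Vin P -> j \in Sin P i ->
    lipschitz_with (edom (h_ P j)) Lgs (gs P i j);
  as_optimal : exists x, P_optimal x;
  as_slater : slater
}.

Definition Lconst (Lg Lgs : R) : R :=
  Num.sqrt ((\max_(i < n) \sum_(j in Vin P | i \in Sin P j) #|Sin P j|)%N%:R
              * Lgs ^+ 2 + 1 + Lg ^+ 2).

Definition sparse_edge : rel 'I_n := fun i j =>
  (i != j) && ((j \in Sin P i :|: Seq P i) || (i \in Sin P j :|: Seq P j)).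

Definition connected_graph (e : rel 'I_n) : bool :=
  [forall i, forall j, connect e i j].

Definition admissible_graph (e : rel 'I_n) : Prop :=
  [/\ symmetric e, irreflexive e &
      if (Vin P == finset.set0) && (Veq P == finset.set0) then
        is_true (connected_graph e)
      else if ((mt P == 0) && (pt P == 0))%N then e =2 sparse_edge
      else if connected_graph sparse_edge then e =2 sparse_edge
      else subrel sparse_edge e /\ connected_graph e].

(* The variable y of the reformulated problem stacks the blocks [x_i; t_i]. *)
Definition ydim (i : 'I_n) : nat := (d i + p)%N.
Notation yvec := 'cV[R]_(\sum_(i < n) ydim i).

Definition xpart (y : yvec) (i : 'I_n) : 'cV[R]_(d i) := usubmx (submxcol y i).
Definition tpart (y : yvec) (i : 'I_n) : 'cV[R]_p := dsubmx (submxcol y i).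

Definition fR (y : yvec) : R := \sum_(i < n) f_ P i (xpart y i).
Definition hR (y : yvec) : \bar R := (\sum_(i < n) h_ P i (xpart y i))%E.
Definition PhiR (y : yvec) : \bar R := ((fR y)%:E + hR y)%E.

Definition Gdim (i : 'I_n) : nat :=
  (p + (if i \in Vin P then pdim P i else 0))%N.
Notation qvec := 'cV[R]_(\sum_(i < n) Gdim i).

Definition GR (y : yvec) : qvec :=
  \mxcol_(i < n) (col_mx (g_ P i (xpart y i) - tpart y i)
     (rows_if (i \in Vin P) (\sum_(j in Sin P i) gs P i j (xpart y j)))
     : 'cV[R]_(Gdim i)).

Notation uvec := 'cV[R]_(\sum_(i < n) r).

Definition Bblk (i : 'I_n) : 'M[R]_(r, ydim i) := block_mx (A_ P i) 0 0 1%:M.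

Definition BR : 'M[R]_(\sum_(i < n) r, \sum_(j < n) ydim j) :=
  \mxblock_(i < n, j < n) (if i == j then Bblk j else 0).

Definition cR : uvec := \mxcol_(i < n) (col_mx (b_ P i) 0 : 'cV[R]_r).

Definition sdim (i : 'I_n) : nat := if i \in Veq P then mdim P i else 0%N.
Notation vtvec := 'cV[R]_(\sum_(i < n) sdim i).

Definition Bsrow (i : 'I_n) : 'M[R]_(mdim P i, \sum_(j < n) ydim j) :=
  \mxrow_(j < n) (if j \in Seq P i then row_mx (As P i j) 0 else 0
                  : 'M[R]_(mdim P i, ydim j)).

Definition BsR : 'M[R]_(\sum_(i < n) sdim i, \sum_(j < n) ydim j) :=
  \mxcol_(i < n) (rows_if (i \in Veq P) (Bsrow i)
                  : 'M[R]_(sdim i, \sum_(j < n) ydim j)).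

Definition csR : vtvec :=
  \mxcol_(i < n) (rows_if (i \in Veq P) (bs P i) : 'cV[R]_(sdim i)).

Definition coupling (y : yvec) : 'cV[R]_r :=
  (ones_kron_id n r)^T *m (BR *m y - cR).

Definition R_feasible (y : yvec) : Prop :=
  [/\ lev (GR y) 0, coupling y = 0 & BsR *m y = csR].

Definition R_optimal : yvec -> Prop := optimal R_feasible PhiR.

Definition R_lagrangian (q : qvec) (u : 'cV[R]_r) (v : vtvec) (y : yvec)
    : \bar R :=
  (PhiR y + (dotv q (GR y) + dotv u (coupling y)
             + dotv v (BsR *m y - csR))%:E)%E.

Definition geometric_multiplier (ystar : yvec) (q : qvec) (u : 'cV[R]_r)
    (v : vtvec) : Prop :=
  lev 0 q /\ is_min_value (R_lagrangian q u v) (PhiR ystar).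

Record mixing_matrices (e : rel 'I_n) (PW PH : 'M[R]_n) : Prop :=
  MixingMatrices {
  mm_sparse : forall i j, ~~ (e i j || (j == i)) -> PW i j = 0 /\ PH i j = 0;
  mm_PW_psd : psdmx PW;
  mm_PH_psd : psdmx PH;
  mm_PW_ones : PW *m const_mx 1 = const_mx 1 :> 'cV[R]_n;
  mm_PH_null : forall x : 'cV[R]_n,
    PH *m x = 0 <-> exists a : R, x = a *: const_mx 1;
  mm_sum : psdmx (1%:M - (PW + PH))
}.

Definition iplux_subproblem (W : 'M[R]_(\sum_(i < n) r))
    (gamma lambda rho alpha : R)
    (yk v : yvec) (u z : uvec) (q : qvec) (y : yvec) : \bar R :=
  ((dotv (grad fR yk) (y - yk)
    + dotv v y
    + gamma * lambda ^+ 2 / 2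
      * enorm (y - yk + (lambda ^+ 2)^-1 *: (BsR^T *m (BsR *m yk - csR))) ^+ 2
    + (2 * rho)^-1 * enorm (BR *m y - cR) ^+ 2
    + dotv (W *m u - rho^-1 *: z) (BR *m y - cR)
    + dotv (q + GR yk) (GR y)
    + alpha / 2 * enorm (y - yk) ^+ 2)%:E + hR y)%E.

Record iplux (W H : 'M[R]_(\sum_(i < n) r)) (gamma lambda rho alpha : R)
    (y v : nat -> yvec) (u z : nat -> uvec) (q : nat -> qvec) : Prop := Iplux {
  iplux_y0 : edom hR (y 0%N);
  iplux_v0 : exists w : vtvec, v 0%N = BsR^T *m w;
  iplux_z0 : z 0%N = rho *: (H *m u 0%N);
  iplux_q0 : q 0%N = maxv (- GR (y 0%N)) 0;
  iplux_y : forall k, is_argmin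
    (iplux_subproblem W gamma lambda rho alpha (y k) (v k) (u k) (z k) (q k))
    (y k.+1);
  iplux_v : forall k,
    v k.+1 = v k + gamma *: (BsR^T *m (BsR *m y k.+1 - csR));
  iplux_u : forall k,
    u k.+1 = W *m u k + rho^-1 *: (BR *m y k.+1 - cR - z k);
  iplux_z : forall k, z k.+1 = z k + rho *: (H *m u k.+1);
  iplux_q : forall k, q k.+1 = maxv (- GR (y k.+1)) (q k + GR (y k.+1))
}.

Definition running_average (y : nat -> yvec) (k : nat) : yvec :=
  k%:R^-1 *: \sum_(1 <= l < k.+1) y l.

End Problem.

Arguments P_objective {R n} P x.
Arguments P_feasible {R n} P x.
Arguments P_optimal {R n} P x.
Arguments fR {R n} P y.
Arguments hR {R n} P y.
Arguments PhiR {R n} P y.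
Arguments GR {R n} P y.
Arguments coupling {R n} P y.
Arguments R_feasible {R n} P y.
Arguments R_optimal {R n} P ystar : rename.
Arguments geometric_multiplier {R n} P ystar q u v.
Arguments iplux {R n} P W H gamma lambda rho alpha y v u z q.

(* Main.v *)
Require Import Defs.
From HB Require Import structures.
From mathcomp Require Import all_boot all_order all_algebra.
From mathcomp Require Import all_classical all_reals all_analysis.
From mathcomp Require Import ring lra.

(** Fix the optimal point y* and let R(k) be the expression R(0) of the theorem
   with the iterates of index k. Everything follows from the inequality

     Phi (y (k+1)) - Phi y* <= R(k) - R(k+1)          (lyapunov_decrease).

   It is obtained by comparing the minimizer y (k+1) of the model with y*.
   - The model is a convex function plus quadratics, so its value at y* exceeds
     the minimum by the quadratics in y* - y (k+1) (sconvex_argmin).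
   - Convexity of f and the descent lemma replace f by its linearization at
     y (k), up to Lf / 2 times the square of y (k+1) - y (k).
   - The three dual updates turn the remaining linear terms into differences of
     squares of dual variables (sparse_equality_step, coupling_step,
     inequality_step).
   - The squares of y (k+1) - y (k) that are left come from f and from
     G (y (k+1)) - G (y (k)); since alpha >= Lf + L^2 and G is L-Lipschitz
     (GR_lipschitz), the proximal term absorbs them.

   The seminorms for pseudo-inverses in R(k) are handled through preimages:
   v (k) = Bs^T w (k) and z (k) - z* = H e (k), where w and e have recursions of
   their own. The choices w (0) = Bs M v (0) and e (0) = H^+ (z (0) - z* ) have
   the norms that occur in R(0) (gram_mpinv, mpinv_range, wnorm_mpinv).

   Summing the inequality, R(k) >= 0 and Jensen's inequality give the upper
   bound for Phi at the average. For the other bounds, the residuals of the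
   constraints at y (1), ..., y (k) add up to increments of q, u and w (with an
   inequality for q). The geometric multiplier therefore bounds the sum of the
   gaps from below by terms linear in these dual iterates, whereas R(k) dominates
   their squares (lyapunov_lower); completing squares bounds q (k), u (k) and
   w (k) independently of k (dual_squares). Division by k gives the feasibility
   rates, and the multiplier inequality at the average then gives the lower bound
   for Phi. *)

Set Implicit Arguments.
Unset Strict Implicit.
Unset Printing Implicit Defensive.

Import Order.TTheory GRing.Theory Num.Theory.
Import numFieldNormedType.Exports.

Local Open Scope classical_set_scope.
Local Open Scope ring_scope.

(** * Inner products and seminorms *)

Section InnerProduct.
Context {R : realType}.

Lemma dotvC m (x y : 'cV[R]_m) : dotv x y = dotv y x.
Proof.
by rewrite /dotv -[in LHS](trmxK y) -trmx_mul mxE.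
Qed.

Lemma dotvDl m (x y w : 'cV[R]_m) : dotv (x + y) w = dotv x w + dotv y w.
Proof. by rewrite /dotv linearD mulmxDl mxE. Qed.

Lemma dotvZl m a (x w : 'cV[R]_m) : dotv (a *: x) w = a * dotv x w.
Proof. by rewrite /dotv linearZ -scalemxAl mxE. Qed.

Lemma dotvNl m (x w : 'cV[R]_m) : dotv (- x) w = - dotv x w.
Proof. by rewrite -scaleN1r dotvZl mulN1r. Qed.

Lemma dotvDr m (w x y : 'cV[R]_m) : dotv w (x + y) = dotv w x + dotv w y.
Proof. by rewrite dotvC dotvDl !(dotvC w). Qed.

Lemma dotvZr m a (w x : 'cV[R]_m) : dotv w (a *: x) = a * dotv w x.
Proof. by rewrite dotvC dotvZl dotvC. Qed.

Lemma dotvNr m (w x : 'cV[R]_m) : dotv w (- x) = - dotv w x.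
Proof. by rewrite dotvC dotvNl dotvC. Qed.

Lemma dot0v m (x : 'cV[R]_m) : dotv 0 x = 0.
Proof. by rewrite -(scale0r 0) dotvZl mul0r. Qed.

Lemma dotv0 m (x : 'cV[R]_m) : dotv x 0 = 0.
Proof. by rewrite dotvC dot0v. Qed.

Definition dotvE := (dotvDl, dotvDr, dotvZl, dotvZr, dotvNl, dotvNr).

Lemma dotvvD m (x y : 'cV[R]_m) :
  dotv (x + y) (x + y) = dotv x x + 2 * dotv x y + dotv y y.
Proof. by rewrite !dotvE (dotvC y x); ring. Qed.

Lemma dotvvB m (x y : 'cV[R]_m) :
  dotv (x - y) (x - y) = dotv x x - 2 * dotv x y + dotv y y.
Proof. by rewrite !dotvE (dotvC y x); ring. Qed.

Lemma dotv_mull m k (A : 'M[R]_(m, k)) x y :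
  dotv (A *m x) y = dotv x (A^T *m y).
Proof. by rewrite /dotv trmx_mul mulmxA. Qed.

Lemma dotv_mulr m k (A : 'M[R]_(m, k)) x y :
  dotv x (A *m y) = dotv (A^T *m x) y.
Proof. by rewrite dotv_mull trmxK. Qed.

Lemma dotv_coord m (x y : 'cV[R]_m) : dotv x y = \sum_i x i 0 * y i 0.
Proof. by rewrite /dotv mxE; apply: eq_bigr => i _; rewrite mxE. Qed.

Lemma dotvv_ge0 m (x : 'cV[R]_m) : 0 <= dotv x x.
Proof. by rewrite dotv_coord sumr_ge0 // => i _; rewrite -expr2 sqr_ge0. Qed.

Lemma dotv_lev m (x y w : 'cV[R]_m) :
  lev 0 w -> lev x y -> dotv w x <= dotv w y.
Proof.
move=> w0 xy; rewrite !dotv_coord; apply: ler_sum => i _.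
by apply: ler_wpM2l (xy i); have := w0 i; rewrite mxE.
Qed.

Lemma dotv_sumr m (I : Type) (s : seq I) (A : pred I) (F : I -> 'cV[R]_m) w :
  dotv w (\sum_(i <- s | A i) F i) = \sum_(i <- s | A i) dotv w (F i).
Proof.
elim/big_rec2: _ => [|i a b _ <-]; first exact: dotv0.
by rewrite dotvDr.
Qed.

Lemma wnorm_ge0 m (A : 'M[R]_m) x : 0 <= wnorm A x.
Proof. exact: sqrtr_ge0. Qed.

Lemma enorm_ge0 m (x : 'cV[R]_m) : 0 <= enorm x.
Proof. exact: sqrtr_ge0. Qed.

Lemma sqr_enorm m (x : 'cV[R]_m) : enorm x ^+ 2 = dotv x x.
Proof. by rewrite sqr_sqrtr // dotvv_ge0. Qed.

Lemma sqr_wnorm m (A : 'M[R]_m) x :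
  psdmx A -> wnorm A x ^+ 2 = dotv x (A *m x).
Proof. by case=> _ A0; rewrite sqr_sqrtr. Qed.

Lemma enorm_wnorm m (x : 'cV[R]_m) : enorm x = wnorm 1%:M x.
Proof. by rewrite /wnorm mul1mx. Qed.

Lemma psdmx1 m : psdmx (1%:M : 'M[R]_m).
Proof. by split=> [|x]; rewrite ?trmx1 // mul1mx dotvv_ge0. Qed.

Lemma psdmx_symm m (A : 'M[R]_m) x y :
  A^T = A -> dotv x (A *m y) = dotv y (A *m x).
Proof. by move=> sA; rewrite dotv_mulr sA dotvC. Qed.

(** The discriminant argument: the form is nonnegative on c x - b y where b is
   the cross term and c the square of y, and on x + t y if c = 0. *)
Lemma psdmx_cauchy_sqr m (A : 'M[R]_m) x y : psdmx A ->
  dotv x (A *m y) ^+ 2 <= dotv x (A *m x) * dotv y (A *m y).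
Proof.
case=> sA A0; set b := dotv x (A *m y); set c := dotv y (A *m y).
set a := dotv x (A *m x).
have E s t : dotv (s *: x + t *: y) (A *m (s *: x + t *: y))
    = s ^+ 2 * a + 2 * s * t * b + t ^+ 2 * c.
  rewrite mulmxDr -!scalemxAr !dotvE (psdmx_symm y x sA) -/a -/b -/c; ring.
have [c0|c0] := ltP 0 c.
  have := A0 (c *: x + (- b) *: y); rewrite E => H.
  rewrite -(ler_pM2l c0) -subr_ge0; apply: le_trans H _.
  by rewrite le_eqVlt; apply/orP; left; apply/eqP; ring.
have {}c0 : c = 0 by apply/eqP; rewrite eq_le c0 A0.
have [->|b0] := eqVneq b 0; first by rewrite c0 mulr0 expr0n.
have := A0 (1 *: x + (- (a + 1) / (2 * b)) *: y); rewrite E c0.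
rewrite (_ : _ + _ = -1) ?oppr_ge0 ?ler10 // expr1n; field; exact: b0.
Qed.

Lemma psdmx_cauchy m (A : 'M[R]_m) x y : psdmx A ->
  dotv x (A *m y) <= wnorm A x * wnorm A y.
Proof.
move=> pA; apply: le_trans (ler_norm _) _.
rewrite -sqrtr_sqr -sqrtrM; last by case: pA.
by apply: ler_wsqrtr; apply: psdmx_cauchy_sqr.
Qed.

Lemma wnormN m (A : 'M[R]_m) x : wnorm A (- x) = wnorm A x.
Proof. by rewrite /wnorm mulmxN dotvNl dotvNr opprK. Qed.

Lemma ler_wnormD m (A : 'M[R]_m) x y : psdmx A ->
  wnorm A (x + y) <= wnorm A x + wnorm A y.
Proof.
move=> pA; rewrite -ler_sqr ?nnegrE ?addr_ge0 ?wnorm_ge0 // sqr_wnorm //.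
rewrite sqrrD !sqr_wnorm // mulmxDr !dotvE.
have := psdmx_cauchy x y pA; rewrite (psdmx_symm y x (proj1 pA)); lra.
Qed.

Lemma dotv_cauchy m (x y : 'cV[R]_m) : dotv x y <= enorm x * enorm y.
Proof.
by have := psdmx_cauchy x y (psdmx1 m); rewrite mul1mx -!enorm_wnorm.
Qed.

Lemma ler_enormD m (x y : 'cV[R]_m) : enorm (x + y) <= enorm x + enorm y.
Proof. by rewrite !enorm_wnorm ler_wnormD //; apply: psdmx1. Qed.

Lemma enormN m (x : 'cV[R]_m) : enorm (- x) = enorm x.
Proof. by rewrite !enorm_wnorm wnormN. Qed.

Lemma enormZ m a (x : 'cV[R]_m) : 0 <= a -> enorm (a *: x) = a * enorm x.
Proof.
move=> a0; rewrite /enorm dotvZl dotvZr mulrA -expr2 sqrtrM ?sqr_ge0 //.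
by rewrite sqrtr_sqr ger0_norm.
Qed.

Lemma enorm_eq0 m (x : 'cV[R]_m) : enorm x = 0 -> x = 0.
Proof. by move=> x0; apply: dotvv_eq0; rewrite -sqr_enorm x0 expr0n. Qed.

Lemma coord_le_enorm m (x : 'cV[R]_m) i : `|x i 0| <= enorm x.
Proof.
rewrite -sqrtr_sqr; apply: ler_wsqrtr; rewrite dotv_coord (bigD1 i) //= -expr2.
by rewrite lerDl sumr_ge0 // => j _; rewrite -expr2 sqr_ge0.
Qed.

(** Testing the bound against the vector itself turns a bound on all inner
   products into a bound on the norm. *)
Lemma enorm_le_dual m (x : 'cV[R]_m) (b : R) : 0 <= b ->
  (forall y, dotv y x <= b * enorm y) -> enorm x <= b.
Proof.
move=> b0 /(_ x); rewrite -sqr_enorm.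
have := enorm_ge0 x; rewrite le_eqVlt => /predU1P[<- //|x0].
by rewrite expr2 ler_pM2r.
Qed.

Lemma dotvv_conv m (x y : 'cV[R]_m) (t : R) :
  dotv (t *: x + (1 - t) *: y) (t *: x + (1 - t) *: y) =
  t * dotv x x + (1 - t) * dotv y y - t * (1 - t) * dotv (x - y) (x - y).
Proof. rewrite !dotvE (dotvC y x); ring. Qed.

Lemma ler_sqrtr_of_sqr (a b : R) : a ^+ 2 <= b -> a <= Num.sqrt b.
Proof.
move=> ab; apply: le_trans (ler_norm _) _.
by rewrite -sqrtr_sqr; apply: ler_wsqrtr.
Qed.

Lemma affine_coord m (s t : R) (x x' : 'cV[R]_m) k :
  (s *: x + t *: x') k 0 = s * x k 0 + t * x' k 0.
Proof. by rewrite !mxE. Qed.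

(** The cross term is split into the squares of x / L and L t, the first of
   which is at most d. *)
Lemma dotv_sub_le m (x t : 'cV[R]_m) (L d : R) : 0 < L ->
  dotv x x <= L ^+ 2 * d ->
  dotv (x - t) (x - t) <= (1 + L ^+ 2) * (d + dotv t t).
Proof.
move=> L0 xd; have sq := dotvv_ge0 (L^-1 *: x + L *: t).
rewrite dotvvD !dotvZl !dotvZr in sq; rewrite dotvvB.
have xdL : L^-1 * (L^-1 * dotv x x) <= d.
  rewrite mulrA -invfM mulrC ler_pdivrMr ?mulr_gt0 //; move: xd; lra.
have cross : 2 * (L^-1 * (L * dotv x t)) = 2 * dotv x t.
  by rewrite mulKf // lt0r_neq0.
rewrite cross in sq.
move: xd xdL sq; lra.
Qed.

Lemma lipschitz_sqr m m' (E : set 'cV[R]_m) (L : R)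
    (g : 'cV[R]_m -> 'cV[R]_m') x x' :
  0 <= L -> lipschitz_with E L g -> E x -> E x' ->
  dotv (g x - g x') (g x - g x') <= L ^+ 2 * dotv (x - x') (x - x').
Proof.
move=> L0 lip Ex Ex'; rewrite -!sqr_enorm -exprMn.
by rewrite ler_sqr ?nnegrE ?mulr_ge0 ?enorm_ge0 //; apply: lip.
Qed.

(** The supremum in the spectral norm is an upper bound only because this set
   is bounded. *)
Lemma spectral_norm_bounded m n (A : 'M[R]_(m, n)) :
  has_ubound [set enorm (A *m x) | x in [set x : 'cV[R]_n | enorm x <= 1]].
Proof.
exists (Num.sqrt (\sum_i (enorm (row i A)^T) ^+ 2)) => _ [x /= x1 <-].
apply: ler_wsqrtr; rewrite dotv_coord; apply: ler_sum => i _.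
have -> : (A *m x) i 0 = dotv (row i A)^T x.
  by rewrite /dotv trmxK -row_mul [RHS]mxE.
rewrite -expr2 -real_normK ?num_real // ler_sqr ?nnegrE ?enorm_ge0 //.
rewrite ler_norml; apply/andP; split.
  rewrite lerNl -dotvNl; apply: le_trans (dotv_cauchy _ _) _.
  by rewrite enormN ler_piMr // enorm_ge0.
by apply: le_trans (dotv_cauchy _ _) _; rewrite ler_piMr // enorm_ge0.
Qed.

Lemma spectral_normP m n (A : 'M[R]_(m, n)) x :
  enorm (A *m x) <= spectral_norm A * enorm x.
Proof.
have [/enorm_eq0 ->|x0] := eqVneq (enorm x) 0.
  by rewrite mulmx0 /enorm !dot0v sqrtr0 mulr0.
have xp : 0 < enorm x by rewrite lt_neqAle eq_sym x0 enorm_ge0.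
rewrite -ler_pdivrMr // mulrC -enormZ ?invr_ge0 ?enorm_ge0 // scalemxAr.
apply: (ub_le_sup (spectral_norm_bounded A)); exists ((enorm x)^-1 *: x) => //=.
by rewrite enormZ ?invr_ge0 ?enorm_ge0 // mulVf.
Qed.

End InnerProduct.

(** * Convexity on a set *)

Section Convexity.
Context {R : realType} {V : lmodType R}.
Implicit Types (D : set V) (f : V -> R) (K : V -> R).

Definition conv_closed D := forall x y t,
  D x -> D y -> 0 <= t <= 1 -> D (t *: x + (1 - t) *: y).

(** The modulus K is kept as an arbitrary function so that the sum of quadratics
   in different images of the variable has the sum of these as its modulus. *)
Definition sconvex_on D f K := forall x y t,
  D x -> D y -> 0 <= t <= 1 ->
  f (t *: x + (1 - t) *: y)
  <= t * f x + (1 - t) * f y - t * (1 - t) * K (x - y).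

Definition convex_on D f := forall x y t,
  D x -> D y -> 0 <= t <= 1 ->
  f (t *: x + (1 - t) *: y) <= t * f x + (1 - t) * f y.

Lemma convex_sconvex D f : convex_on D f -> sconvex_on D f (fun=> 0).
Proof. by move=> cf x y t Dx Dy t01; rewrite mulr0 subr0; apply: cf. Qed.

Lemma sconvex_onD D f1 f2 K1 K2 :
  sconvex_on D f1 K1 -> sconvex_on D f2 K2 ->
  sconvex_on D (fun x => f1 x + f2 x) (fun x => K1 x + K2 x).
Proof.
move=> s1 s2 x y t Dx Dy t01.
have := lerD (s1 x y t Dx Dy t01) (s2 x y t Dx Dy t01).
lra.
Qed.

Lemma convex_on_sum D (I : Type) (s : seq I) (A : pred I)
    (k : I -> V -> R) :
  (forall l, A l -> convex_on D (k l)) ->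
  convex_on D (fun y => \sum_(l <- s | A l) k l y).
Proof.
move=> ck a b t Da Db t01; rewrite !mulr_sumr -big_split.
by apply: ler_sum => i Ai; exact: ck.
Qed.

(** Comparing with the points of the segment towards y that are close to the
   minimizer x recovers the whole modulus. *)
Lemma sconvex_argmin D f K x y : conv_closed D -> sconvex_on D f K ->
  D x -> D y -> (forall w, D w -> f x <= f w) -> f x + K (y - x) <= f y.
Proof.
move=> cD sf Dx Dy xmin; set k := K (y - x).
have seg t : 0 < t <= 1 -> (1 - t) * k <= f y - f x.
  case/andP => t0 t1; rewrite -(ler_pM2l t0).
  have t01 : 0 <= t <= 1 by rewrite (ltW t0) t1.
  have := le_trans (xmin _ (cD y x t Dy Dx t01)) (sf y x t Dy Dx t01).
  rewrite -/k; lra.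
have yx : f x <= f y by apply: xmin.
rewrite leNgt; apply/negP => lt_k.
have k0 : 0 < k by lra.
have := seg ((k - (f y - f x)) / (2 * k)).
rewrite divr_gt0 ?ler_pdivrMr ?mulr_gt0 //; [|lra].
have -> : (1 - (k - (f y - f x)) / (2 * k)) * k = (k + (f y - f x)) / 2.
  by field; rewrite gt_eqF.
by move=> /(_ ltac:(apply/andP; split=> //; lra)); lra.
Qed.

Definition average (y : nat -> V) k := k%:R^-1 *: \sum_(1 <= l < k.+1) y l.

Lemma averageS (y : nat -> V) k (t := k.+1%:R / k.+2%:R : R) :
  average y k.+2 = t *: average y k.+1 + (1 - t) *: y k.+2.
Proof.
have tE : 1 - t = k.+2%:R^-1.
  rewrite /t -[in k.+1%:R]addn1 -[in k.+2%:R]addn2 !natrD; field.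
  by rewrite -natrD pnatr_eq0 addn2.
rewrite tE /average scalerA /t mulrAC divff ?pnatr_eq0 // mul1r -scalerDr.
by rewrite (@big_nat_recr _ _ _ k.+2 1) //=.
Qed.

Lemma average_in D (y : nat -> V) k : conv_closed D ->
  (forall l, D (y l.+1)) -> D (average y k.+1).
Proof.
move=> cD Dy; elim: k => [|k IH].
  by rewrite /average big_nat1 invr1 scale1r.
rewrite averageS; apply: cD => //.
by rewrite divr_ge0 ?ler0n // ler_pdivrMr ?ltr0n // mul1r ler_nat leqnSn.
Qed.

Lemma jensen_average D f (y : nat -> V) k : conv_closed D -> convex_on D f ->
  (forall l, D (y l.+1)) ->
  f (average y k.+1) <= k.+1%:R^-1 * \sum_(1 <= l < k.+2) f (y l).
Proof.
move=> cD cf Dy; elim: k => [|k IH].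
  by rewrite /average !big_nat1 invr1 scale1r mul1r.
have t0 : 0 <= k.+1%:R / k.+2%:R :> R by rewrite divr_ge0 ?ler0n.
rewrite averageS; apply: le_trans (cf _ _ _ (average_in k cD Dy) (Dy _) _) _.
  by rewrite t0 ler_pdivrMr ?ltr0n // mul1r ler_nat leqnSn.
apply: le_trans (lerD (ler_wpM2l t0 IH) (lexx _)) _.
rewrite (@big_nat_recr _ _ _ k.+2 1) //= le_eqVlt; apply/orP; left; apply/eqP.
rewrite -[in k.+1%:R]addn1 -[in k.+2%:R]addn2 !natrD; field.
by rewrite -natrD natr1 !pnatr_eq0 addn2.
Qed.

End Convexity.

Section QuadraticConvexity.
Context {R : realType} {N m : nat}.

Lemma sconvex_sqr (D : set 'cV[R]_N) (A : 'M[R]_(m, N)) b k :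
  sconvex_on D (fun y => k * dotv (A *m y - b) (A *m y - b))
               (fun w => k * dotv (A *m w) (A *m w)).
Proof.
move=> x y t _ _ _.
have -> : A *m (t *: x + (1 - t) *: y) - b
          = t *: (A *m x - b) + (1 - t) *: (A *m y - b).
  by rewrite mulmxDr -!scalemxAr !scalerBr addrACA -opprD -scalerDl
             subrKC scale1r.
rewrite dotvv_conv (_ : A *m x - b - (A *m y - b) = A *m (x - y)); last first.
  by rewrite mulmxBr opprB addrA subrK.
lra.
Qed.

Lemma convex_affine (D : set 'cV[R]_N) (A : 'M[R]_(m, N)) b p :
  convex_on D (fun y => dotv p (A *m y - b)).
Proof.
move=> x y t _ _ _; rewrite mulmxDr -!scalemxAr !dotvE; lra.
Qed.

Lemma convex_dotv (D : set 'cV[R]_N) (g : 'cV[R]_N -> 'cV[R]_m) p :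
  lev 0 p -> (forall i, convex_on D (fun x => g x i 0)) ->
  convex_on D (fun y => dotv p (g y)).
Proof.
move=> p0 cg x y t Dx Dy t01; rewrite -!dotvZr -dotvDr; apply: dotv_lev => // i.
by rewrite !mxE; apply: cg.
Qed.

End QuadraticConvexity.

(** * Multiplier updates for the inequality constraints *)

Section InequalityMultipliers.
Context {R : realType} {m : nat}.
Implicit Types q g : 'cV[R]_m.

(** The update of the inequality multipliers; the lower bound - g, instead of 0,
   is what makes q + g nonnegative after the update. *)
Definition ineq_update q g := maxv (- g) (q + g).

Lemma ineq_updateE q g i :
  ineq_update q g i 0 = Num.max (- g i 0) (q i 0 + g i 0).
Proof. by rewrite !mxE. Qed.

Lemma ineq_update_ge0 q g : lev 0 q -> lev 0 (ineq_update q g).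
Proof.
move=> q0 i; have := q0 i; rewrite ineq_updateE !mxE le_max => qi.
have [g0|g0] := leP (g i 0) 0; first by rewrite oppr_ge0 g0.
by rewrite addr_ge0 ?orbT // ltW.
Qed.

Lemma ineq_update_shift_ge0 q g : lev 0 (ineq_update q g + g).
Proof.
move=> i; rewrite mxE [leRHS]mxE ineq_updateE -lerBlDr sub0r le_max.
by rewrite lexx.
Qed.

Lemma ineq_update_ge q g : lev (q + g) (ineq_update q g).
Proof. by move=> i; rewrite ineq_updateE mxE le_max lexx orbT. Qed.

Lemma ineq_update_dominates q g : lev 0 q ->
  dotv g g <= dotv (ineq_update q g) (ineq_update q g).
Proof.
move=> q0; rewrite !dotv_coord; apply: ler_sum => i _.
rewrite ineq_updateE; have := q0 i; rewrite mxE => qi.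
case: (lerP (- g i 0)) => H; last by rewrite mulrNN.
have qg : 0 <= q i 0 + 2 * g i 0 by lra.
by have := mulr_ge0 qi qg; lra.
Qed.

(** Where the maximum is - g, the gap between both sides is (q + g)^2; where
   it is q + g, the gap is g^2. *)
Lemma ineq_update_drift q g :
  dotv (ineq_update q g) (ineq_update q g) <=
  dotv q q + 2 * dotv q g + 2 * dotv g g.
Proof.
rewrite !dotv_coord !mulr_sumr -!big_split; apply: ler_sum => i _ /=.
rewrite ineq_updateE; case: (lerP (- g i 0)) => H;
  have := sqr_ge0 (q i 0 + g i 0); have := sqr_ge0 (g i 0); lra.
Qed.

End InequalityMultipliers.

(** * One step of the method *)

Section PrimalDualStep.
Context {R : realType}.

(** The proximal weight lambda^2 absorbs the error made by evaluating the
   augmented Lagrangian term of the sparse equalities at the previous point. *)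
Lemma sparse_equality_step N s (Bs : 'M[R]_(s, N)) (cs w : 'cV_s)
    (yk yn x : 'cV_N) (gamma lambda : R)
    (b := (lambda ^+ 2)^-1 *: (Bs^T *m (Bs *m yk - cs)))
    (wn := w + gamma *: (Bs *m yn - cs)) :
  0 < gamma -> 0 < lambda ->
  (forall d, dotv (Bs *m d) (Bs *m d) <= lambda ^+ 2 * dotv d d) ->
  Bs *m x = cs ->
  dotv (Bs^T *m w) x + gamma * lambda ^+ 2 / 2 * dotv (x - yk + b) (x - yk + b)
  - dotv (Bs^T *m w) yn
  - gamma * lambda ^+ 2 / 2 * dotv (yn - yk + b) (yn - yk + b)
  <= gamma * lambda ^+ 2 / 2 * dotv (x - yk) (x - yk)
     + (2 * gamma)^-1 * (dotv w w - dotv wn wn).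
Proof.
move=> g0 l0 lip Bx; rewrite /wn {wn}.
move Es1: (Bs *m yn - cs) => s1; move Es0: (Bs *m yk - cs) => s0 in b *.
have wD : dotv (Bs^T *m w) x - dotv (Bs^T *m w) yn = - dotv w s1.
  by rewrite !dotv_mull trmxK -Es1 Bx !dotvE; ring.
have bE a : dotv a b = (lambda ^+ 2)^-1 * dotv s0 (Bs *m a).
  by rewrite /b dotvZr dotvC dotv_mull trmxK.
have bD : dotv (x - yk) b = dotv (yn - yk) b - (lambda ^+ 2)^-1 * dotv s0 s1.
  by rewrite !bE !mulmxBr Bx -Es1 !dotvE; ring.
have lipk : gamma * (dotv s1 s1 - 2 * dotv s1 s0 + dotv s0 s0)
         <= gamma * (lambda ^+ 2 * dotv (yn - yk) (yn - yk)).
  rewrite -dotvvB; apply: (ler_wpM2l (ltW g0)); apply: le_trans (lip _).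
  by rewrite mulmxBr -Es1 -Es0 opprB addrA subrK.
have s00 : 0 <= gamma * dotv s0 s0 by rewrite mulr_ge0 ?dotvv_ge0 // ltW.
have -> : (2 * gamma)^-1
            * (dotv w w - dotv (w + gamma *: s1) (w + gamma *: s1))
          = - dotv w s1 - gamma / 2 * dotv s1 s1.
  by rewrite dotvvD !dotvE; field; exact: lt0r_neq0.
have quad : gamma * lambda ^+ 2 / 2 * dotv (x - yk + b) (x - yk + b)
    - gamma * lambda ^+ 2 / 2 * dotv (yn - yk + b) (yn - yk + b)
  = gamma * lambda ^+ 2 / 2 * dotv (x - yk) (x - yk)
    - gamma * lambda ^+ 2 / 2 * dotv (yn - yk) (yn - yk)
    - gamma * dotv s1 s0.
  by rewrite !(dotvvD _ b) bD (dotvC s0); field; exact: lt0r_neq0.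
move: lipk s00 wD quad; lra.
Qed.

(** The vector z - (B x - c) is written H e so that its seminorm for the
   pseudo-inverse of H becomes the form of H at e; this form evolves along
   e + rho u, and the gap W + H <= I pays for the squares of u. *)
Lemma coupling_step m (W H : 'M[R]_m) (u e a Z : 'cV_m) (rho : R)
    (z := Z + H *m e) (un := W *m u + rho^-1 *: (a - z))
    (en := e + rho *: un) :
  0 < rho -> psdmx W -> psdmx H -> psdmx (1%:M - (W + H)) ->
  (2 * rho)^-1 * dotv Z Z + dotv (W *m u - rho^-1 *: z) Z
  - (2 * rho)^-1 * dotv a a - dotv (W *m u - rho^-1 *: z) a
  - (2 * rho)^-1 * dotv (Z - a) (Z - a)
  <= (2 * rho)^-1 * (dotv e (H *m e) - dotv en (H *m en))
     + rho / 2 * (dotv u (W *m u) - dotv un (W *m un)).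
Proof.
move=> r0 [sW pW] [sH pH] [_ pI]; have r1 : rho != 0 by exact: lt0r_neq0.
have aE : Z - a = rho *: (W *m u - un) - H *m e.
  rewrite /un opprD addNKr -scalerN scalerA mulfV // scale1r opprB /z.
  by rewrite addrAC addrK.
have -> : (2 * rho)^-1 * dotv Z Z + dotv (W *m u - rho^-1 *: z) Z
    - (2 * rho)^-1 * dotv a a - dotv (W *m u - rho^-1 *: z) a
    - (2 * rho)^-1 * dotv (Z - a) (Z - a) = dotv un (Z - a).
  rewrite /un; move: (z) (W *m u) => z' v.
  by rewrite !dotvE (dotvC Z a); field.
rewrite aE /en; move: (un) (pI un) (pH un) (pW (un - u)) => {z un en aE} v.
rewrite mulmxBl mul1mx (mulmxDl W) => gap vH cross.
have -> : (2 * rho)^-1 * (dotv e (H *m e)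
             - dotv (e + rho *: v) (H *m (e + rho *: v)))
          = - dotv v (H *m e) - rho / 2 * dotv v (H *m v).
  by rewrite mulmxDr -!scalemxAr !dotvE (psdmx_symm e v sH); field.
have := ler_wpM2l (ltW r0) gap; have := ler_wpM2l (ltW r0) cross.
have := mulr_ge0 (ltW r0) vH.
rewrite !mulmxBr !dotvE (psdmx_symm u v sW); lra.
Qed.

(** The drift of q leaves the square of gn, which merges with the cross term of
   gk and gn into the square of gn - gk. *)
Lemma inequality_step m (q gk gn gx : 'cV[R]_m) (l : R)
    (qn := ineq_update q gn) :
  lev 0 (q + gk) -> lev gx 0 -> dotv (gn - gk) (gn - gk) <= l ->
  dotv (q + gk) gx - dotv (q + gk) gn
  <= 2^-1 * (dotv q q - dotv gk gk) - 2^-1 * (dotv qn qn - dotv gn gn)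
     + 2^-1 * l.
Proof.
move=> qg gx0 lip.
have := ineq_update_drift q gn; rewrite -/qn => drift.
have := dotv_lev qg gx0; rewrite dotv0 => le0.
move: lip; rewrite dotvvB (dotvC gn gk) => lip.
move: le0; rewrite !dotvDl => le0; lra.
Qed.

End PrimalDualStep.

(** * Lyapunov analysis *)

(** The method for general data: f and h are real-valued on the convex domain D
   of h, S stands for the stacked identities 1 (x) I, with nS their number, and
   x for a minimizer. The preimages w0 and e0 represent the seminorms of the
   initial values for pseudo-inverses. *)
Section Lyapunov.
Context {R : realType} {N m s Q r : nat}.
Variables (D : set 'cV[R]_N) (f h : 'cV[R]_N -> R).
Variable gradf : 'cV[R]_N -> 'cV[R]_N.
Variables (G : 'cV[R]_N -> 'cV[R]_Q) (B : 'M[R]_(m, N)) (c : 'cV[R]_m).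
Variables (Bs : 'M[R]_(s, N)) (cs : 'cV[R]_s).
Variables (W H : 'M[R]_m) (S : 'M[R]_(m, r)).
Variables (gamma lambda rho alpha Lf L2 nS : R).

Hypothesis D_conv : conv_closed D.
Hypothesis h_conv : convex_on D h.
Hypothesis f_lower : forall a b,
  D a -> D b -> f a + dotv (gradf a) (b - a) <= f b.
Hypothesis f_upper : forall a b, D a -> D b ->
  f b <= f a + dotv (gradf a) (b - a) + Lf / 2 * dotv (b - a) (b - a).
Hypothesis G_conv : forall i, convex_on D (fun a => G a i 0).
Hypothesis G_lip : forall a b, D a -> D b ->
  dotv (G a - G b) (G a - G b) <= L2 * dotv (a - b) (a - b).
Hypothesis Bs_bound :
  forall a, dotv (Bs *m a) (Bs *m a) <= lambda ^+ 2 * dotv a a.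
Hypothesis gamma_gt0 : 0 < gamma.
Hypothesis lambda_gt0 : 0 < lambda.
Hypothesis rho_gt0 : 0 < rho.
Hypothesis Lf_ge0 : 0 <= Lf.
Hypothesis alpha_ge : Lf + L2 <= alpha.
Hypothesis W_psd : psdmx W.
Hypothesis H_psd : psdmx H.
Hypothesis WH_le1 : psdmx (1%:M - (W + H)).

Variables (y : nat -> 'cV[R]_N) (u z : nat -> 'cV[R]_m) (q : nat -> 'cV[R]_Q).
Variables (v : nat -> 'cV[R]_N).
Hypothesis y_dom : forall k, D (y k).

(** The finite part of the minimized function; h is added separately. *)
Definition primal_model k (a : 'cV[R]_N) : R :=
  dotv (gradf (y k)) (a - y k) + dotv (v k) a
  + gamma * lambda ^+ 2 / 2
    * enorm (a - y k + (lambda ^+ 2)^-1 *: (Bs^T *m (Bs *m y k - cs))) ^+ 2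
  + (2 * rho)^-1 * enorm (B *m a - c) ^+ 2
  + dotv (W *m u k - rho^-1 *: z k) (B *m a - c)
  + dotv (q k + G (y k)) (G a)
  + alpha / 2 * enorm (a - y k) ^+ 2.

Hypothesis y_step : forall k a, D a ->
  primal_model k (y k.+1) + h (y k.+1) <= primal_model k a + h a.
Hypothesis v_step : forall k,
  v k.+1 = v k + gamma *: (Bs^T *m (Bs *m y k.+1 - cs)).
Hypothesis u_step : forall k,
  u k.+1 = W *m u k + rho^-1 *: (B *m y k.+1 - c - z k).
Hypothesis z_step : forall k, z k.+1 = z k + rho *: (H *m u k.+1).
Hypothesis q_init : q 0%N = maxv (- G (y 0%N)) 0.
Hypothesis q_step : forall k, q k.+1 = ineq_update (q k) (G (y k.+1)).

Variables (x : 'cV[R]_N) (w0 : 'cV[R]_s) (e0 : 'cV[R]_m).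
Hypothesis x_dom : D x.
Hypothesis Gx_le0 : lev (G x) 0.
Hypothesis Bs_x : Bs *m x = cs.
Hypothesis v_init : v 0%N = Bs^T *m w0.
Hypothesis z_init : z 0%N = B *m x - c + H *m e0.

(** v (k) is the image by the transpose of Bs of this vector, see v_range. *)
Definition range_dual k : 'cV[R]_s :=
  w0 + gamma *: \sum_(1 <= l < k.+1) (Bs *m y l - cs).

(** z (k) - (B x - c) is the image by H of this vector, see z_range. *)
Definition null_offset k : 'cV[R]_m := e0 + rho *: \sum_(1 <= l < k.+1) u l.

Definition lyapunov k : R :=
  (2 * rho)^-1 * dotv (null_offset k) (H *m null_offset k)
  + rho / 2 * dotv (u k) (W *m u k)
  + (2 * gamma)^-1 * dotv (range_dual k) (range_dual k)
  + (gamma * lambda ^+ 2 + alpha) / 2 * dotv (y k - x) (y k - x)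
  + 2^-1 * dotv (q k) (q k) - 2^-1 * dotv (G (y k)) (G (y k)).

Lemma range_dual0 : range_dual 0%N = w0.
Proof. by rewrite /range_dual big_geq // scaler0 addr0. Qed.

Lemma range_dualS k :
  range_dual k.+1 = range_dual k + gamma *: (Bs *m y k.+1 - cs).
Proof. by rewrite /range_dual big_nat_recr //= scalerDr addrA. Qed.

Lemma null_offset0 : null_offset 0%N = e0.
Proof. by rewrite /null_offset big_geq // scaler0 addr0. Qed.

Lemma null_offsetS k : null_offset k.+1 = null_offset k + rho *: u k.+1.
Proof. by rewrite /null_offset big_nat_recr //= scalerDr addrA. Qed.

Lemma v_range k : v k = Bs^T *m range_dual k.
Proof.
elim: k => [|k IH]; first by rewrite range_dual0.
by rewrite v_step IH range_dualS (mulmxDr _ (range_dual k)) -scalemxAr.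
Qed.

Lemma z_range k : z k = B *m x - c + H *m null_offset k.
Proof.
elim: k => [|k IH]; first by rewrite null_offset0.
by rewrite z_step IH null_offsetS (mulmxDr H (null_offset k)) -scalemxAr addrA.
Qed.

Lemma q_ge0 k : lev 0 (q k).
Proof.
elim: k => [|k IH]; last by rewrite q_step; apply: ineq_update_ge0.
by move=> i; rewrite q_init !mxE le_max lexx orbT.
Qed.

Lemma q_shift_ge0 k : lev 0 (q k + G (y k)).
Proof.
case: k => [|k]; last by rewrite q_step; apply: ineq_update_shift_ge0.
by move=> i; rewrite q_init !mxE -lerBlDr sub0r le_max lexx.
Qed.

Lemma alpha_dist (a b : 'cV[R]_N) :
  Lf * dotv (a - b) (a - b) + L2 * dotv (a - b) (a - b)
    <= alpha * dotv (a - b) (a - b).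
Proof. by rewrite -mulrDl ler_wpM2r // dotvv_ge0. Qed.

(** A quadratic form is its own modulus of strong convexity, so the quadratic
   part of the model contributes its full value at x - y (k+1). *)
Lemma primal_step k :
  primal_model k (y k.+1) + h (y k.+1)
  + (gamma * lambda ^+ 2 / 2 * dotv (x - y k.+1) (x - y k.+1)
     + (2 * rho)^-1 * dotv (B *m (x - y k.+1)) (B *m (x - y k.+1))
     + alpha / 2 * dotv (x - y k.+1) (x - y k.+1))
  <= primal_model k x + h x.
Proof.
set b := (lambda ^+ 2)^-1 *: (Bs^T *m (Bs *m y k - cs)).
have s1 := convex_sconvex (convex_affine (D := D) 1%:M (y k) (gradf (y k))).
have s2 := convex_sconvex (convex_affine (D := D) 1%:M 0 (v k)).
have s3 := sconvex_sqr (D := D) 1%:M (y k - b) (gamma * lambda ^+ 2 / 2).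
have s4 := sconvex_sqr (D := D) B c (2 * rho)^-1.
have s5 := convex_sconvex
  (convex_affine (D := D) B c (W *m u k - rho^-1 *: z k)).
have s6 := convex_sconvex (convex_dotv (@q_shift_ge0 k) G_conv).
have s7 := sconvex_sqr (D := D) 1%:M (y k) (alpha / 2).
have s8 := convex_sconvex h_conv.
have sc := sconvex_onD (sconvex_onD (sconvex_onD (sconvex_onD (sconvex_onD
  (sconvex_onD (sconvex_onD s1 s2) s3) s4) s5) s6) s7) s8.
have FE a : (dotv (gradf (y k)) (1%:M *m a - y k) + dotv (v k) (1%:M *m a - 0) +
    gamma * lambda ^+ 2 / 2 *
      dotv (1%:M *m a - (y k - b)) (1%:M *m a - (y k - b)) +
    (2 * rho)^-1 * dotv (B *m a - c) (B *m a - c) +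
    dotv (W *m u k - rho^-1 *: z k) (B *m a - c) +
    dotv (q k + G (y k)) (G a) +
    alpha / 2 * dotv (1%:M *m a - y k) (1%:M *m a - y k) + h a)
   = primal_model k a + h a.
  by rewrite /primal_model !sqr_enorm !mul1mx subr0 opprB addrA addrAC.
have KE d : (0 + 0 + gamma * lambda ^+ 2 / 2 * dotv (1%:M *m d) (1%:M *m d)
    + (2 * rho)^-1 * dotv (B *m d) (B *m d) + 0 + 0
    + alpha / 2 * dotv (1%:M *m d) (1%:M *m d) + 0)
   = gamma * lambda ^+ 2 / 2 * dotv d d + (2 * rho)^-1 * dotv (B *m d) (B *m d)
     + alpha / 2 * dotv d d.
  by rewrite !mul1mx !add0r !addr0.
pose F a := primal_model k a + h a.
pose K d := gamma * lambda ^+ 2 / 2 * dotv d d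
            + (2 * rho)^-1 * dotv (B *m d) (B *m d) + alpha / 2 * dotv d d.
have scF : sconvex_on D F K.
  move=> a1 a2 t Da1 Da2 t01; rewrite /F /K -!FE -KE; exact: sc.
exact: (sconvex_argmin D_conv scF (y_dom k.+1) x_dom (y_step k)).
Qed.

(** Convexity and smoothness of f bound the gap by its linearization plus a
   square; the optimality of y (k+1) bounds the linearization; the remaining
   cross terms telescope through the three dual updates, and the leftover
   squares of y (k+1) - y k are absorbed by alpha. *)
Lemma lyapunov_decrease k :
  f (y k.+1) + h (y k.+1) - (f x + h x) <= lyapunov k - lyapunov k.+1.
Proof.
have P := primal_step k; rewrite /primal_model !sqr_enorm in P.
have up := f_upper (y_dom k) (y_dom k.+1).
have lo := f_lower (y_dom k) x_dom.
have V := sparse_equality_step (range_dual k) (y k) (y k.+1) gamma_gt0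
            lambda_gt0 Bs_bound Bs_x.
rewrite -v_range -range_dualS in V.
have U := coupling_step (u k) (null_offset k) (B *m y k.+1 - c) (B *m x - c)
            rho_gt0 W_psd H_psd WH_le1.
rewrite -z_range -u_step -null_offsetS in U.
have BE : B *m x - c - (B *m y k.+1 - c) = B *m (x - y k.+1).
  by rewrite mulmxBr opprB addrA subrK.
rewrite BE in U.
have qs := inequality_step (@q_shift_ge0 k) Gx_le0
             (G_lip (y_dom k.+1) (y_dom k)).
rewrite -q_step in qs.
have al := alpha_dist (y k.+1) (y k).
have sw a : dotv (a - x) (a - x) = dotv (x - a) (x - a).
  by rewrite -opprB dotvNl dotvNr opprK.
rewrite /lyapunov !sw.
move: P up lo V U qs al; lra.
Qed.

Lemma lyapunov_sum k :
  \sum_(1 <= l < k.+1) (f (y l) + h (y l)) - k%:R * (f x + h x)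
  <= lyapunov 0%N - lyapunov k.
Proof.
elim: k => [|k IH]; first by rewrite big_geq // mul0r !subrr.
by rewrite big_nat_recr //= -natr1; have := lyapunov_decrease k; lra.
Qed.

Lemma alpha_G_dist a b : D a -> D b ->
  dotv (G a - G b) (G a - G b) <= alpha * dotv (a - b) (a - b).
Proof.
move=> Da Db; have := G_lip Da Db; have := alpha_dist a b.
by have := mulr_ge0 Lf_ge0 (dotvv_ge0 (a - b)); lra.
Qed.

Lemma quad_terms_ge0 k :
  [/\ 0 <= (2 * rho)^-1 * dotv (null_offset k) (H *m null_offset k),
      0 <= rho / 2 * dotv (u k) (W *m u k),
      0 <= (2 * gamma)^-1 * dotv (range_dual k) (range_dual k) &
      0 <= gamma * lambda ^+ 2 / 2 * dotv (y k - x) (y k - x)].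
Proof.
have r0 := ltW rho_gt0; have g0 := ltW gamma_gt0.
have [_ pH] := H_psd; have [_ pW] := W_psd.
have gl0 := mulr_ge0 g0 (sqr_ge0 lambda).
split; apply: mulr_ge0 => //; try exact: dotvv_ge0.
- by rewrite invr_ge0 mulr_ge0.
- by rewrite divr_ge0.
- by rewrite invr_ge0 mulr_ge0.
- by rewrite divr_ge0.
Qed.

Lemma alpha_ge0_dist k : 0 <= alpha / 2 * dotv (y k - x) (y k - x).
Proof.
have := alpha_G_dist (y_dom k) x_dom.
by have := dotvv_ge0 (G (y k) - G x); lra.
Qed.

(** At k = 0 the difference of squares is minus the square of the positive part
   of G (y 0), which is at most the squared distance of G (y 0) to G x <= 0. *)
Lemma lyapunov_ge0 k : 0 <= lyapunov k.
Proof.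
have [t1 t2 t3 t4] := quad_terms_ge0 k.
have t5 : dotv (G (y k)) (G (y k))
          <= dotv (q k) (q k) + alpha * dotv (y k - x) (y k - x).
  case: k {t1 t2 t3 t4} => [|k]; last first.
    rewrite q_step; have := ineq_update_dominates (G (y k.+1)) (q_ge0 k).
    by have := alpha_ge0_dist k.+1; lra.
  apply: le_trans (lerD (lexx _) (alpha_G_dist (y_dom 0%N) x_dom)).
  rewrite !dotv_coord -big_split; apply: ler_sum => i _ /=.
  rewrite q_init !mxE; have := Gx_le0 i; rewrite mxE.
  set a := G (y 0%N) i 0; set b := G x i 0 => b0.
  case: (lerP (- a) 0) => a0; last by have := sqr_ge0 (a - b); lra.
  have ab : 0 <= a * - b by rewrite mulr_ge0; lra.
  by have := sqr_ge0 b; lra.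
rewrite /lyapunov; move: t1 t2 t3 t4 t5; lra.
Qed.

(** The negative term of the Lyapunov function is compensated by the distance
   term, up to the fixed square of G x; here q >= - G (y k) and G x <= 0 give
   the sign of the cross term. *)
Lemma lyapunov_lower k :
  4^-1 * dotv (q k) (q k) - 2^-1 * dotv (G x) (G x)
  + rho / 2 * dotv (u k) (W *m u k)
  + (2 * gamma)^-1 * dotv (range_dual k) (range_dual k) <= lyapunov k.
Proof.
have [t1 t2 t3 t4] := quad_terms_ge0 k.
have t5 := alpha_G_dist (y_dom k) x_dom.
rewrite (dotvvB (G (y k))) in t5.
have t6 : dotv (q k) (G x) + dotv (G (y k)) (G x) <= 0.
  rewrite -dotvDl -(dotv0 (q k + G (y k))).
  exact: dotv_lev (q_shift_ge0 _) _.
have t7 : 0 <= 4^-1 * dotv (q k) (q k) + dotv (q k) (G x) + dotv (G x) (G x).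
  have := dotvv_ge0 (2^-1 *: q k + G x).
  by rewrite dotvvD !dotvZl !dotvZr; lra.
rewrite /lyapunov; move: t1 t2 t3 t4 t5 t6 t7; lra.
Qed.

Hypothesis f_conv : convex_on D f.
Hypothesis W_S : W *m S = S.
Hypothesis H_S : H *m S = 0.
Hypothesis nS_ge0 : 0 <= nS.
Hypothesis S_norm : forall a : 'cV[R]_r, dotv (S *m a) (S *m a) = nS * dotv a a.
Hypothesis coupling_x : S^T *m (B *m x - c) = 0.

Variables (qs : 'cV[R]_Q) (us : 'cV[R]_r) (vs : 'cV[R]_s).
Hypothesis qs_ge0 : lev 0 qs.
Hypothesis saddle : forall a, D a ->
  f x + h x <= f a + h a + (dotv qs (G a) + dotv us (S^T *m (B *m a - c))
                            + dotv vs (Bs *m a - cs)).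

(** q (k+1) >= q (k) + G (y (k+1)), and q (0) >= 0. *)
Lemma sum_G_le_q k : lev (\sum_(1 <= l < k.+1) G (y l)) (q k).
Proof.
elim: k => [|k IH] i; first by rewrite big_geq //; apply: q_ge0.
rewrite big_nat_recr //= q_step mxE.
apply: le_trans (ineq_update_ge _ _ i); rewrite mxE lerD2r; exact: IH.
Qed.

Lemma coupling_z k : S^T *m z k = 0.
Proof.
rewrite z_range mulmxDr coupling_x add0r mulmxA.
by rewrite -(proj1 H_psd) -trmx_mul H_S trmx0 mul0mx.
Qed.

Lemma sum_coupling k :
  S^T *m \sum_(1 <= l < k.+1) (B *m y l - c) = rho *: (S^T *m (u k - u 0%N)).
Proof.
have SW : S^T *m W = S^T by rewrite -(proj1 W_psd) -trmx_mul W_S.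
elim: k => [|k IH]; first by rewrite big_geq // subrr mulmx0 scaler0.
have -> : u k.+1 - u 0%N
    = W *m u k - u 0%N + rho^-1 *: (B *m y k.+1 - c - z k).
  by rewrite u_step addrAC.
rewrite big_nat_recr //= [LHS]mulmxDr {}IH.
move: (B *m y k.+1 - c) (coupling_z k) => b Sz.
have -> : S^T *m (W *m u k - u 0%N + rho^-1 *: (b - z k))
    = S^T *m (u k - u 0%N) + rho^-1 *: (S^T *m b).
  rewrite mulmxDr -scalemxAr (mulmxBr _ b) Sz subr0.
  by rewrite mulmxBr mulmxA SW -mulmxBr.
by rewrite scalerDr scalerA mulfV ?scale1r // lt0r_neq0.
Qed.

Lemma sum_sparse k : \sum_(1 <= l < k.+1) (Bs *m y l - cs)
                     = gamma^-1 *: (range_dual k - w0).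
Proof.
by rewrite /range_dual addrAC subrr add0r scalerA mulVf ?scale1r // lt0r_neq0.
Qed.

(** The residuals of the constraints are the increments of the multipliers, so
   the saddle inequalities sum to terms in the final multipliers. *)
Lemma sum_gap_ge k :
  - dotv qs (q k) - rho * dotv us (S^T *m (u k - u 0%N))
  - gamma^-1 * dotv vs (range_dual k - w0)
  <= \sum_(1 <= l < k.+1) (f (y l) + h (y l)) - k%:R * (f x + h x).
Proof.
have step l : f x + h x <= f (y l) + h (y l) + (dotv qs (G (y l))
    + dotv us (S^T *m (B *m y l - c)) + dotv vs (Bs *m y l - cs)).
  exact: saddle.
have : \sum_(1 <= l < k.+1) (f x + h x) <=
       \sum_(1 <= l < k.+1) (f (y l) + h (y l) + (dotv qs (G (y l))
    + dotv us (S^T *m (B *m y l - c)) + dotv vs (Bs *m y l - cs))).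
  exact: ler_sum.
rewrite sumr_const_nat subn1 /= -[X in X <= _]mulr_natl !big_split /=.
rewrite -!dotv_sumr -mulmx_sumr sum_coupling sum_sparse !dotvZr.
have := dotv_lev qs_ge0 (sum_G_le_q k); lra.
Qed.

(** W fixes the range of S, so the seminorm of W controls the image by S^T. *)
Lemma coupling_dual_bound (a : 'cV[R]_r) (d : 'cV[R]_m) :
  dotv a (S^T *m d) <= Num.sqrt nS * enorm a * wnorm W d.
Proof.
have -> : S^T *m d = S^T *m (W *m d).
  by rewrite mulmxA -(proj1 W_psd) -trmx_mul W_S.
rewrite -dotv_mull; apply: le_trans (psdmx_cauchy _ _ W_psd) _.
by rewrite /wnorm mulmxA W_S S_norm sqrtrM.
Qed.

(** The norm of w0 stands for the seminorm of v (0) in the constant C of the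
   rates. *)
Definition rate_const : R :=
  lyapunov 0%N + rho * Num.sqrt nS * enorm us * wnorm W (u 0%N)
  + gamma^-1 * enorm vs * enorm w0 + rho * nS / 2 * enorm us ^+ 2
  + (2 * gamma)^-1 * enorm vs ^+ 2 + enorm qs ^+ 2 + 2^-1 * enorm (G x) ^+ 2.

(** The Lyapunov function is at most its initial value plus terms linear in the
   norms of the dual iterates; completing the squares bounds these norms. *)
Lemma dual_squares k :
  4^-1 * (enorm (q k) - 2 * enorm qs) ^+ 2
  + rho / 2 * (wnorm W (u k) - Num.sqrt nS * enorm us) ^+ 2
  + (2 * gamma)^-1 * (enorm (range_dual k) - enorm vs) ^+ 2 <= rate_const.
Proof.
have lo := lyapunov_lower k.
have up := le_trans (sum_gap_ge k) (lyapunov_sum k).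
have b1 : dotv qs (q k) <= enorm qs * enorm (q k) by exact: dotv_cauchy.
have b2 : rho * dotv us (S^T *m (u k - u 0%N))
          <= rho * (Num.sqrt nS * enorm us * (wnorm W (u k) + wnorm W (u 0%N))).
  apply: (ler_wpM2l (ltW rho_gt0)); apply: le_trans (coupling_dual_bound _ _) _.
  apply: ler_wpM2l; first by rewrite mulr_ge0 ?sqrtr_ge0.
  by rewrite -(wnormN _ (u 0%N)); apply: ler_wnormD.
have b3 : gamma^-1 * dotv vs (range_dual k - w0)
          <= gamma^-1 * (enorm vs * (enorm (range_dual k) + enorm w0)).
  apply: ler_wpM2l; first by rewrite invr_ge0 ltW.
  apply: le_trans (dotv_cauchy _ _) _; apply: ler_wpM2l; first exact: enorm_ge0.
  by rewrite -(enormN w0); apply: ler_enormD.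
have sS : Num.sqrt nS ^+ 2 = nS by rewrite sqr_sqrtr.
have g2 : (2 * gamma)^-1 = 2^-1 * gamma^-1 by rewrite invfM.
rewrite /rate_const g2 !sqrrB !exprMn sS.
rewrite -!sqr_enorm -(sqr_wnorm _ W_psd) g2 in lo.
by move: lo up b1 b2 b3; lra.
Qed.

Lemma dual_norms k :
  [/\ enorm (q k) <= 2 * (enorm qs + Num.sqrt rate_const),
      wnorm W (u k)
        <= Num.sqrt nS * enorm us + Num.sqrt (2 * rate_const / rho) &
      enorm (range_dual k) <= enorm vs + Num.sqrt (2 * gamma * rate_const)].
Proof.
have := dual_squares k; move: rate_const => C.
set a := _ - _; set b := wnorm _ _ - _; set d := enorm _ - enorm vs => H0.
have pa : 0 <= 4^-1 * a ^+ 2 by rewrite mulr_ge0 ?sqr_ge0 // invr_ge0.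
have pb : 0 <= rho / 2 * b ^+ 2.
  by rewrite mulr_ge0 ?sqr_ge0 // divr_ge0 // ltW.
have pd : 0 <= (2 * gamma)^-1 * d ^+ 2.
  by rewrite mulr_ge0 ?sqr_ge0 // invr_ge0 mulr_ge0 // ltW.
have ha : a / 2 <= Num.sqrt C by apply: ler_sqrtr_of_sqr; lra.
have hb : b <= Num.sqrt (2 * C / rho).
  by apply: ler_sqrtr_of_sqr; rewrite ler_pdivlMr //; lra.
have hd : d <= Num.sqrt (2 * gamma * C).
  apply: ler_sqrtr_of_sqr; rewrite -ler_pdivrMl ?mulr_gt0 //; lra.
by split; [move: ha|move: hb|move: hd]; rewrite /a /b /d; lra.
Qed.

Definition rate_q := 2 * (enorm qs + Num.sqrt rate_const).
Definition rate_u := Num.sqrt nS * (wnorm W (u 0%N) + Num.sqrt nS * enorm us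
                       + Num.sqrt (2 * rate_const / rho)).
Definition rate_v := enorm w0 + enorm vs + Num.sqrt (2 * gamma * rate_const).

Lemma rates_ge0 : [/\ 0 <= rate_q, 0 <= rate_u & 0 <= rate_v].
Proof.
by split; rewrite ?mulr_ge0 ?addr_ge0 ?mulr_ge0 ?sqrtr_ge0.
Qed.

Let ybar := average y.

Lemma ybar_dom k : D (ybar k.+1).
Proof. exact: average_in. Qed.

Lemma ybar_linear p (A : 'M[R]_(p, N)) b k :
  A *m ybar k.+1 - b = k.+1%:R^-1 *: \sum_(1 <= l < k.+2) (A *m y l - b).
Proof.
rewrite /ybar /average -scalemxAr mulmx_sumr sumrB scalerBr; congr (_ - _).
rewrite sumr_const_nat subn1 /= -(scaler_nat _ b) scalerA.
by rewrite mulVf ?scale1r // pnatr_eq0.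
Qed.

Lemma ergodic_inequality k : lev (G (ybar k.+1)) (const_mx (rate_q / k.+1%:R)).
Proof.
move=> i; rewrite mxE.
apply: le_trans (jensen_average k D_conv (G_conv i) (fun l => y_dom l.+1)) _.
rewrite mulrC ler_pM2r ?invr_gt0 ?ltr0n //.
have := sum_G_le_q k.+1 i; rewrite summxE => /le_trans; apply.
apply: le_trans (ler_norm _) _; apply: le_trans (coord_le_enorm _ _) _.
by have [] := dual_norms k.+1.
Qed.

Lemma ergodic_coupling k :
  enorm (S^T *m (B *m ybar k.+1 - c)) <= rho * rate_u / k.+1%:R.
Proof.
have k0 : 0 <= k.+1%:R^-1 :> R by rewrite invr_ge0 ler0n.
rewrite ybar_linear -scalemxAr sum_coupling enormZ // mulrC.
apply: ler_wpM2r => //; rewrite enormZ ?(ltW rho_gt0) //.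
apply: (ler_wpM2l (ltW rho_gt0)).
have [_ ru _] := rates_ge0; apply: enorm_le_dual => // a.
apply: le_trans (coupling_dual_bound _ _) _.
rewrite mulrAC /rate_u; apply: ler_wpM2r; first exact: enorm_ge0.
apply: ler_wpM2l; first exact: sqrtr_ge0.
apply: le_trans (ler_wnormD _ _ W_psd) _; rewrite wnormN addrC -addrA lerD2l.
by have [] := dual_norms k.+1.
Qed.

Lemma ergodic_sparse k :
  enorm (Bs *m ybar k.+1 - cs) <= rate_v / (gamma * k.+1%:R).
Proof.
have k0 : 0 <= k.+1%:R^-1 :> R by rewrite invr_ge0 ler0n.
have g0 : 0 <= gamma^-1 by rewrite invr_ge0 ltW.
rewrite ybar_linear sum_sparse !enormZ // invfM.
have -> : rate_v * (gamma^-1 * k.+1%:R^-1)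
          = k.+1%:R^-1 * (gamma^-1 * rate_v) by ring.
apply: (ler_wpM2l k0); apply: (ler_wpM2l g0).
apply: le_trans (ler_enormD _ _) _; rewrite enormN /rate_v addrC -addrA lerD2l.
by have [] := dual_norms k.+1.
Qed.

Lemma ergodic_upper k :
  f (ybar k.+1) + h (ybar k.+1) - (f x + h x) <= lyapunov 0%N / k.+1%:R.
Proof.
have fh : convex_on D (fun a => f a + h a).
  move=> a b t Da Db t01; have := f_conv Da Db t01; have := h_conv Da Db t01.
  by lra.
have := jensen_average k D_conv fh (fun l => y_dom l.+1); rewrite /= => J.
have k0 : 0 < k.+1%:R^-1 :> R by rewrite invr_gt0 ltr0n.
have sum := lyapunov_sum k.+1; have pos := lyapunov_ge0 k.+1.
have : \sum_(1 <= l < k.+2) (f (y l) + h (y l)) - k.+1%:R * (f x + h x)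
       <= lyapunov 0%N by move: sum pos; lra.
rewrite -(ler_pM2l k0) mulrBr mulKf ?pnatr_eq0 // => K.
apply: le_trans (lerB J (lexx _)) _; rewrite [leRHS]mulrC; exact: K.
Qed.

Lemma ergodic_lower k :
  - ((rate_q * dotv (const_mx 1) qs + rho * rate_u * enorm us
      + rate_v * enorm vs / gamma) / k.+1%:R)
  <= f (ybar k.+1) + h (ybar k.+1) - (f x + h x).
Proof.
have sd := saddle (ybar_dom k).
have b1 : dotv qs (G (ybar k.+1))
          <= rate_q * dotv (const_mx 1) qs / k.+1%:R.
  apply: le_trans (dotv_lev qs_ge0 (ergodic_inequality k)) _.
  rewrite (_ : const_mx _ = (rate_q / k.+1%:R) *: const_mx 1).
    by rewrite dotvZr dotvC mulrAC.
  by apply/matrixP => i j; rewrite !mxE mulr1.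
have b2 : dotv us (S^T *m (B *m ybar k.+1 - c))
          <= rho * rate_u * enorm us / k.+1%:R.
  apply: le_trans (dotv_cauchy _ _) _; rewrite mulrC mulrAC.
  by apply: ler_wpM2r; [exact: enorm_ge0 | exact: ergodic_coupling].
have b3 : dotv vs (Bs *m ybar k.+1 - cs)
          <= rate_v * enorm vs / gamma / k.+1%:R.
  apply: le_trans (dotv_cauchy _ _) _; rewrite mulrC -mulrA -invfM mulrAC.
  by apply: ler_wpM2r; [exact: enorm_ge0 | exact: ergodic_sparse].
move: sd b1 b2 b3; move: rate_q rate_u rate_v (k.+1%:R^-1) => rq ru rv t.
lra.
Qed.

Lemma rate_lower_ge0 : 0 <= rate_q * dotv (const_mx 1) qs
  + rho * rate_u * enorm us + rate_v * enorm vs / gamma.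
Proof.
have [rq ru rv] := rates_ge0.
have q1 : 0 <= dotv (const_mx 1) qs.
  rewrite dotvC -(dotv0 qs); apply: dotv_lev => // i.
  by rewrite !mxE.
have r0 := ltW rho_gt0; have g0 : 0 <= gamma^-1 by rewrite invr_ge0 ltW.
have us0 := enorm_ge0 us; have vs0 := enorm_ge0 vs.
move: rate_q rate_u rate_v rq ru rv => a b d a0 b0 d0.
by rewrite !addr_ge0 ?mulr_ge0.
Qed.

Definition rate_lower : R := rate_q * dotv (const_mx 1) qs
  + rho * rate_u * enorm us + rate_v * enorm vs / gamma.

Theorem ergodic_rates :
  [/\ 0 <= rate_q, 0 <= rate_u, 0 <= rate_v, 0 <= rate_lower
     & 0 <= lyapunov 0%N] /\
  forall k, [/\ D (average y k.+1),
    lev (G (average y k.+1)) (const_mx (rate_q / k.+1%:R)),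
    enorm (S^T *m (B *m average y k.+1 - c)) <= rho * rate_u / k.+1%:R,
    enorm (Bs *m average y k.+1 - cs) <= rate_v / (gamma * k.+1%:R) &
    - (rate_lower / k.+1%:R)
      <= f (average y k.+1) + h (average y k.+1) - (f x + h x)
      <= lyapunov 0%N / k.+1%:R].
Proof.
split=> [|k]; last split.
- have [rq ru rv] := rates_ge0; split=> //; last exact: lyapunov_ge0.
  exact: rate_lower_ge0.
- exact: ybar_dom.
- exact: ergodic_inequality.
- exact: ergodic_coupling.
- exact: ergodic_sparse.
- by rewrite ergodic_lower ergodic_upper.
Qed.

End Lyapunov.

(** * First-order bounds for convex functions with Lipschitz gradient *)

Section FirstOrderBounds.
Context {R : realType}.

Lemma convex_setP (V : lmodType R) (D : set V) : convex_set D -> conv_closed D.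
Proof.
move=> cD x y t Dx Dy /andP[t0 t1].
by have := cD x y (Itv01 t0 t1) (mem_set Dx) (mem_set Dy); rewrite inE.
Qed.

Lemma convex_functionP (V : lmodType R) (D : set V) (f : V -> R) :
  convex_function D f -> convex_on D f.
Proof.
move=> cf x y t Dx Dy /andP[t0 t1].
exact: (cf (Itv01 t0 t1) x y (mem_set Dx) (mem_set Dy)).
Qed.

(** Covers the restriction of a function to a line and its composition with the
   projection onto a block of coordinates. *)
Lemma is_derive_comp_affine (U V W : normedModType R) (f : V -> W) (g : U -> V)
    (a w : U) (v : V) (df : W) :
  (forall t, g (t *: w + a) = t *: v + g a) ->
  is_derive (g a) v f df -> is_derive a w (f \o g) df.
Proof.
move=> gE [df1 df2].
have E : (fun h : R => h^-1 *: (((f \o g) \o shift a) (h *: w) - (f \o g) a))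
       = (fun h : R => h^-1 *: ((f \o shift (g a)) (h *: v) - f (g a))).
  by apply/funext => h /=; rewrite gE.
by apply: DeriveDef; rewrite /derivable /derive E.
Qed.

Lemma derive_grad d (f : 'cV[R]_d -> R) x v :
  differentiable f x -> 'D_v f x = dotv (grad f x) v.
Proof.
move=> df; rewrite deriveE // dotv_coord.
rewrite {1}[v]matrix_sum_delta linear_sum; apply: eq_bigr => i _.
by rewrite big_ord1 linearZ mxE deriveE // mulrC.
Qed.

Lemma convex_derive_le (V : normedModType R) (D : set V) (f : V -> R) x y :
  convex_on D f -> D x -> D y -> derivable f x (y - x) ->
  f x + 'D_(y - x) f x <= f y.
Proof.
move=> cf Dx Dy df; rewrite -lerBrDl.
apply: (@cvgr_to_le _ _ _ _ _ _ _ (cvg_dnbhs_at_right df)).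
near=> h; have h0 : 0 < h by near: h; exact: nbhs_right_gt.
have h1 : h < 1 by near: h; exact: nbhs_right_lt.
have := cf y x h Dy Dx; rewrite (ltW h0) (ltW h1) => /(_ isT).
have -> : h *: y + (1 - h) *: x = h *: (y - x) + x.
  by rewrite scalerBl scale1r scalerBr -addrA (addrC (- _)).
move=> cfh; rewrite /= -[_ *: _]/(_ * _) mulrC ler_pdivrMr //; move: cfh; lra.
Unshelve. all: by end_near. Qed.

(** The function t |-> f (x + t d) - t <grad f x, d> - L t^2 |d|^2 / 2 has a
   nonpositive derivative on [0, 1]. *)
Lemma descent_lemma d (D : set 'cV[R]_d) (f : 'cV[R]_d -> R) L x y :
  conv_closed D -> (forall a, D a -> differentiable f a) ->
  lipschitz_with D L (grad f) -> D x -> D y ->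
  f y <= f x + dotv (grad f x) (y - x) + L / 2 * dotv (y - x) (y - x).
Proof.
move=> cD dfD lip Dx Dy; set w := y - x.
have seg (t : R) : 0 <= t <= 1 -> D (t *: w + x).
  move=> t01; have -> : t *: w + x = t *: y + (1 - t) *: x.
    by rewrite scalerBl scale1r scalerBr -addrA (addrC (- _)).
  exact: cD.
pose g (t : R) := t *: w + x.
pose psi (t : R) := (f \o g) t - t * dotv (grad f x) w
                    - t ^+ 2 * (L / 2 * dotv w w).
pose dpsi (t : R) := dotv (grad f (g t)) w - dotv (grad f x) w
                     - t * (L * dotv w w).
have psi_der (t : R) : 0 <= t <= 1 -> is_derive t 1 psi (dpsi t).
  move=> t01; have df := dfD _ (seg t t01).
  have fg : is_derive t (1 : R) (f \o g) (dotv (grad f (g t)) w).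
    apply: (is_derive_comp_affine (v := w)).
      by move=> s; rewrite /g [s *: 1]mulr1 scalerDl addrA.
    rewrite -derive_grad //; exact/derivableP/diff_derivable.
  rewrite /psi; apply: is_derive_eq; rewrite /dpsi.
  by rewrite !scaler0 !add0r /GRing.scale /= !mulr1; field.
have [||c /andP[c0 c1]] := @MVT R psi dpsi 0 1 ltr01.
- move=> t; rewrite in_itv /= => /andP[t0 t1]; apply: psi_der.
  by rewrite !ltW.
- apply: derivable_within_continuous => t; rewrite in_itv /= => t01.
  by case: (psi_der t t01).
rewrite subr0 mulr1 => psiE.
have c01 : 0 <= c <= 1 by rewrite !ltW.
have le0 : dpsi c <= 0.
  rewrite /dpsi -dotvNl -dotvDl subr_le0 //.
  apply: le_trans (dotv_cauchy _ _) _.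
  apply: le_trans (ler_wpM2r (enorm_ge0 _) (lip _ _ (seg c c01) Dx)) _.
  rewrite addrK enormZ ?(ltW c0) // -sqr_enorm; lra.
move: psiE le0; rewrite /psi /g /= !scale0r scale1r add0r subrK; lra.
Qed.

End FirstOrderBounds.

(** * Block vectors and Kronecker products with an identity *)

Section Blocks.
Context {R : realType}.

Lemma dotv_blocks n (p_ : 'I_n -> nat) (x y : 'cV[R]_(\sum_(i < n) p_ i)) :
  dotv x y = \sum_i dotv (submxcol x i) (submxcol y i).
Proof.
rewrite /dotv -{1}(submxcolK x) -{1}(submxcolK y) tr_mxcol mul_mxrow_mxcol.
by rewrite summxE.
Qed.

Lemma dotv_col_mx a b (x1 y1 : 'cV[R]_a) (x2 y2 : 'cV[R]_b) :
  dotv (col_mx x1 x2) (col_mx y1 y2) = dotv x1 y1 + dotv x2 y2.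
Proof. by rewrite /dotv tr_col_mx mul_row_col mxE. Qed.

Lemma dotv_split a b (x y : 'cV[R]_(a + b)) :
  dotv x y = dotv (usubmx x) (usubmx y) + dotv (dsubmx x) (dsubmx y).
Proof. by rewrite -{1}(vsubmxK x) -{1}(vsubmxK y) dotv_col_mx. Qed.

Lemma lev_blocks n (p_ : 'I_n -> nat) (x y : 'cV[R]_(\sum_(i < n) p_ i)) :
  (forall i, lev (submxcol x i) (submxcol y i)) -> lev x y.
Proof.
move=> xy k; have := xy (tagnat.sig1 k) (tagnat.sig2 k).
by rewrite !mxE tagnat.sig2K.
Qed.

Lemma lev_rows_if (c : bool) m (x x' : 'cV[R]_m) :
  (c -> lev x x') -> lev (rows_if c x) (rows_if c x').
Proof. by case: c => [|_ []] //=; apply. Qed.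

Lemma rows_if_conv (c : bool) m (s t : R) (x x' : 'cV[R]_m) :
  s *: rows_if c x + t *: rows_if c x' = rows_if c (s *: x + t *: x').
Proof. by case: c => //=; rewrite !scaler0 addr0. Qed.

Lemma dotv_rows_if (c : bool) m (x x' : 'cV[R]_m) :
  dotv (rows_if c x - rows_if c x') (rows_if c x - rows_if c x')
  = if c then dotv (x - x') (x - x') else 0.
Proof. by case: c => //=; rewrite subr0 dot0v. Qed.

Lemma submxcol_affine n (p_ : 'I_n -> nat) (s t : R)
    (x x' : 'cV[R]_(\sum_(i < n) p_ i)) i :
  submxcol (s *: x + t *: x') i = s *: submxcol x i + t *: submxcol x' i.
Proof. by apply/matrixP => k l; rewrite !mxE. Qed.

Lemma lev_col_mx a b (x1 y1 : 'cV[R]_a) (x2 y2 : 'cV[R]_b) :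
  lev x1 y1 -> lev x2 y2 -> lev (col_mx x1 x2) (col_mx y1 y2).
Proof.
move=> l1 l2 k; rewrite !mxE.
by case: (fintype.split k) => j; [apply: l1 | apply: l2].
Qed.

Lemma dotv_sum_le m (I : finType) (A : {pred I}) (F : I -> 'cV[R]_m) :
  dotv (\sum_(i in A) F i) (\sum_(i in A) F i)
  <= #|A|%:R * \sum_(i in A) dotv (F i) (F i).
Proof.
have E : dotv (\sum_(i in A) F i) (\sum_(i in A) F i)
         = \sum_(i in A) \sum_(j in A) dotv (F i) (F j).
  by rewrite dotv_sumr; apply: eq_bigr => i _; rewrite dotvC dotv_sumr.
rewrite E; set N := \sum_(i in A) dotv (F i) (F i).
(* Symmetrize the target so that the comparison is termwise. *)
have -> : #|A|%:R * N
  = \sum_(i in A) \sum_(j in A) (dotv (F i) (F i) / 2 + dotv (F j) (F j) / 2).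
  under eq_bigr do rewrite big_split sumr_const /=.
  rewrite big_split /= sumr_const sumrMnl -!mulr_suml -/N.
  by rewrite -(mulr_natl (N / 2)); field.
apply: ler_sum => i _; apply: ler_sum => j _.
by have := dotvv_ge0 (F i - F j); rewrite dotvvB; lra.
Qed.

Lemma mulmx_ext m n (A B : 'M[R]_(m, n)) :
  (forall x : 'cV_n, A *m x = B *m x) -> A = B.
Proof.
move=> AB; apply: (can_inj trmxK); apply/row_matrixP => i.
by rewrite -!tr_col !colE AB.
Qed.

End Blocks.

Section Kronecker.
Context {R : realType} {n r : nat}.
Implicit Types (x y : 'cV[R]_(\sum_(i < n) r)) (P : 'M[R]_n).

(** The vector of the s-th coordinates of all blocks: P (x) I acts on each such
   slice as P. *)
Definition slice s x : 'cV[R]_n :=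
  \col_i (submxcol (p_ := fun=> r) x i) s 0.

Lemma dotv_slice x y : dotv x y = \sum_s dotv (slice s x) (slice s y).
Proof.
rewrite (dotv_blocks (p_ := fun=> r)).
under eq_bigr do rewrite dotv_coord.
rewrite exchange_big; apply: eq_bigr => s _; rewrite dotv_coord.
by apply: eq_bigr => i _; rewrite [slice _ _ _ _]mxE [slice _ y _ _]mxE.
Qed.

Lemma slice_ext x y : (forall s, slice s x = slice s y) -> x = y.
Proof.
move=> xy; apply/(mxcolP (p_ := fun=> r)) => i; apply/matrixP => s j.
by rewrite ord1; have /matrixP/(_ i 0) := xy s; rewrite [LHS]mxE [RHS]mxE.
Qed.

Lemma sliceD s x y : slice s (x + y) = slice s x + slice s y.
Proof. by apply/matrixP => i j; rewrite !mxE. Qed.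

Lemma sliceN s x : slice s (- x) = - slice s x.
Proof. by apply/matrixP => i j; rewrite !mxE. Qed.

Lemma slice0 s : slice s 0 = 0.
Proof. by apply/matrixP => i j; rewrite !mxE. Qed.

Lemma slice_kron s P x : slice s (kron_id P r *m x) = P *m slice s x.
Proof.
apply/matrixP => i j; rewrite ord1 [LHS]mxE -submxcol_mul submxcol_matrix.
rewrite -{1}(submxcolK (p_ := fun=> r) x) mul_mxrow_mxcol summxE [RHS]mxE.
by apply: eq_bigr => k _; rewrite mul_scalar_mx mxE [slice _ _ _ _]mxE.
Qed.

Lemma slice_ones s (a : 'cV[R]_r) :
  slice s (ones_kron_id n r *m a) = a s 0 *: const_mx 1.
Proof.
apply/matrixP => i j; rewrite [LHS]mxE -submxcol_mul mxcolK mul1mx.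
by rewrite [RHS]mxE mxE mulr1.
Qed.

Lemma psdmx_kron P : psdmx P -> psdmx (kron_id P r).
Proof.
case=> sP pP; split.
  rewrite /kron_id tr_mxblock; apply/eq_mxblockP => i j.
  by rewrite tr_scalar_mx -[in RHS]sP mxE.
by move=> x; rewrite dotv_slice sumr_ge0 // => s _; rewrite slice_kron.
Qed.

Lemma kron_id_gap P1 P2 :
  1%:M - (kron_id P1 r + kron_id P2 r) = kron_id (1%:M - (P1 + P2)) r.
Proof.
apply: mulmx_ext => x; apply: slice_ext => s; rewrite slice_kron.
rewrite !mulmxBl !mul1mx !mulmxDl -[in RHS]slice_kron.
by rewrite -[in RHS]slice_kron !sliceD sliceN sliceD.
Qed.

(** Used with a = 1 for W and a = 0 for H. *)
Lemma kron_ones P (a : R) : P *m const_mx 1 = a *: (const_mx 1 : 'cV_n) ->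
  kron_id P r *m ones_kron_id n r = a *: ones_kron_id n r.
Proof.
move=> P1; apply: mulmx_ext => x; apply: slice_ext => s.
rewrite -mulmxA slice_kron slice_ones -scalemxAr P1 scalerA mulrC.
by rewrite -scalemxAl scalemxAr slice_ones mxE.
Qed.

Lemma ones_kron_sqr (a : 'cV[R]_r) :
  dotv (ones_kron_id n r *m a) (ones_kron_id n r *m a) = n%:R * dotv a a.
Proof.
rewrite dotv_slice [dotv a a]dotv_coord mulr_sumr; apply: eq_bigr => s _.
rewrite slice_ones dotvZl dotvZr mulrA mulrC; congr (_ * _).
rewrite dotv_coord; under eq_bigr do rewrite !mxE mulr1.
by rewrite sumr_const card_ord.
Qed.

Lemma kron_null P x :
  (forall w : 'cV_n, P *m w = 0 -> exists a : R, w = a *: const_mx 1) ->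
  kron_id P r *m x = 0 -> exists a : 'cV_r, x = ones_kron_id n r *m a.
Proof.
move=> PN Px; have /choice [a aE] s : exists a : R, slice s x = a *: const_mx 1.
  by apply: PN; rewrite -slice_kron Px slice0.
exists (\col_s a s); apply: slice_ext => s.
by rewrite aE slice_ones mxE.
Qed.

End Kronecker.

Section PseudoInverse.
Context {R : realType}.

(** A symmetric matrix inverts on the orthogonal complement of its kernel, which
   is contained in the range of S. *)
Lemma mpinv_range m r (H : 'M[R]_m) (S : 'M[R]_(m, r)) (x : 'cV_m) :
  H^T = H ->
  (forall w : 'cV_m, H *m w = 0 -> exists a, w = S *m a) ->
  S^T *m x = 0 -> H *m (mpinv H *m x) = x.
Proof.
move=> sH HN Sx; have [HXH _ sHX _] := mpinvP H.
set w := x - H *m (mpinv H *m x).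
have Hw : H *m w = 0.
  have HHX : H *m (H *m mpinv H) = H.
    by apply: (can_inj trmxK); rewrite trmx_mul sHX sH.
  by rewrite /w mulmxBr !mulmxA -(mulmxA H) HHX subrr.
suff w0 : w = 0 by apply/eqP; rewrite eq_sym -subr_eq0 -/w w0.
have [a wa] := HN _ Hw; apply: dotvv_eq0.
rewrite {2}/w dotvDr dotvNr {1}wa dotv_mull Sx dotv0.
by rewrite dotv_mulr sH Hw dot0v subr0.
Qed.

Lemma wnorm_mpinv m (H : 'M[R]_m) x : psdmx H ->
  H *m (mpinv H *m x) = x ->
  wnorm (mpinv H) x ^+ 2 = dotv (mpinv H *m x) (H *m (mpinv H *m x)).
Proof.
move=> [_ pH] Hx; have E : dotv x (mpinv H *m x)
    = dotv (mpinv H *m x) (H *m (mpinv H *m x)) by rewrite Hx dotvC.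
by rewrite /wnorm sqr_sqrtr E.
Qed.

(** The range of the transpose of A is that of the Gram matrix, so a vector
   there has the preimage A M v, whose norm is the seminorm of v. *)
Lemma gram_mpinv m n (A : 'M[R]_(m, n)) v (M := mpinv (A^T *m A)) :
  (exists w, v = A^T *m w) ->
  A^T *m (A *m (M *m v)) = v /\ enorm (A *m (M *m v)) = wnorm M v.
Proof.
case=> w vE; have [GXG _ sGX _] := mpinvP (A^T *m A).
have Gv : A^T *m A *m (M *m v) = v.
  (* E is the defect of A^T as a fixed point of the projection onto the range
     of the Gram matrix; E A = 0 implies E E^T = 0. *)
  pose E := (A^T *m A) *m M *m A^T - A^T.
  have E0 : E *m A = 0.
    by rewrite /E mulmxBl -(mulmxA _ A^T A) GXG subrr.
  have EE : E *m E^T = 0.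
    have -> : E^T = A *m (A^T *m A *m M) - A.
      by rewrite /E linearB /= trmx_mul trmxK sGX.
    by rewrite mulmxBr (mulmxA E A) E0 mul0mx subr0.
  have Ez : E = 0.
    apply: (can_inj trmxK); rewrite trmx0.
    apply: mulmx_ext => x; rewrite mul0mx.
    by apply: dotvv_eq0; rewrite dotv_mull trmxK mulmxA EE mul0mx dotv0.
  move/eqP: Ez; rewrite /E subr_eq0 => /eqP Ez.
  by rewrite vE !mulmxA Ez.
split; first by rewrite mulmxA.
by rewrite /enorm /wnorm dotv_mull [A^T *m _]mulmxA Gv dotvC.
Qed.

End PseudoInverse.

(** * The reformulated problem *)

Section Reformulation.
Context {R : realType} {n : nat}.
Variable P : problem R n.
Notation yvec := 'cV[R]_(\sum_(i < n) ydim P i).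
Implicit Types (a b y : yvec) (i j : 'I_n).

Lemma xpart_affine (s t : R) a b i :
  xpart (s *: a + t *: b) i = s *: xpart a i + t *: xpart b i.
Proof. by apply/matrixP => k l; rewrite !mxE. Qed.

Lemma tpart_affine (s t : R) a b i :
  tpart (s *: a + t *: b) i = s *: tpart a i + t *: tpart b i.
Proof. by apply/matrixP => k l; rewrite !mxE. Qed.

Lemma xpartB a b i : xpart (a - b) i = xpart a i - xpart b i.
Proof. by apply/matrixP => k l; rewrite !mxE. Qed.

Lemma tpartB a b i : tpart (a - b) i = tpart a i - tpart b i.
Proof. by apply/matrixP => k l; rewrite !mxE. Qed.

Lemma dotv_parts a b :
  dotv a b
  = \sum_i (dotv (xpart a i) (xpart b i) + dotv (tpart a i) (tpart b i)).
Proof. by rewrite dotv_blocks; apply: eq_bigr => i _; rewrite dotv_split. Qed.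

Lemma sum_dotv_xpart_le a : \sum_i dotv (xpart a i) (xpart a i) <= dotv a a.
Proof.
by rewrite dotv_parts; apply: ler_sum => i _; rewrite lerDl dotvv_ge0.
Qed.

Section Domain.
Hypothesis wf : problem_wf P.

Lemma edom_hRP y : edom (hR P) y <-> forall i, edom (h_ P i) (xpart y i).
Proof.
split=> [|hi]; last first.
  by apply: lte_sum_pinfty => i _; exact: hi.
rewrite /edom /= ltey => hy i; rewrite ltey; apply: contra hy => /eqP hi.
apply/eqP; apply/esum_eqyP; first by move=> j _; apply/eqP; exact: (wf_h wf).
by exists i; rewrite mem_index_enum.
Qed.

Lemma h_fin i x : edom (h_ P i) x -> h_ P i x \is a fin_num.
Proof.
rewrite /edom /= ltey fin_numE => ->; rewrite andbT.
apply/eqP; exact: (wf_h wf).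
Qed.

Lemma hR_fin y : edom (hR P) y ->
  hR P y = (\sum_i fine (h_ P i (xpart y i)))%:E.
Proof.
move=> /edom_hRP hy; rewrite /hR -sumEFin; apply: eq_bigr => i _.
by rewrite fineK // h_fin.
Qed.

Lemma PhiR_fin y : edom (hR P) y ->
  PhiR P y = (fR P y + fine (hR P y))%:E.
Proof. by move=> hy; rewrite /PhiR hR_fin. Qed.

End Domain.

Section Regularity.
Variables (Lf Lg Lgs : R).
Hypothesis wf : problem_wf P.
Hypothesis asm : problem_assumption P Lf Lg Lgs.
Let D : set yvec := edom (hR P).

Lemma domain_part y i : D y -> edom (h_ P i) (xpart y i).
Proof. by move=> /(edom_hRP wf). Qed.

Lemma domain_conv : conv_closed D.
Proof.
move=> a b t Da Db t01; apply/(edom_hRP wf) => i; rewrite xpart_affine.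
exact: (convex_setP (as_dom_convex asm (i := i)) (domain_part i Da)
         (domain_part i Db) t01).
Qed.

Lemma convex_on_xpart i (k : 'cV[R]_(xdim P i) -> R) :
  convex_on (edom (h_ P i)) k -> convex_on D (fun y => k (xpart y i)).
Proof.
move=> ck a b t Da Db t01; rewrite xpart_affine.
by apply: ck => //; apply: domain_part.
Qed.

Lemma fR_convex : convex_on D (fR P).
Proof.
apply: convex_on_sum => i _; apply: convex_on_xpart.
exact: (convex_functionP (as_f_convex asm (i := i))).
Qed.

Lemma hR_convex : convex_on D (fun y => fine (hR P y)).
Proof.
move=> a b t Da Db t01; rewrite !(hR_fin wf) //=; last exact: domain_conv.
have cv : convex_on D (fun y => \sum_i fine (h_ P i (xpart y i))).
  apply: convex_on_sum => i _.
  have ch := convex_functionP (as_h_convex asm (i := i)).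
  exact: (convex_on_xpart ch).
exact: cv.
Qed.

Lemma fR_gradE y w : D y ->
  dotv (grad (fR P) y) w = \sum_i dotv (grad (f_ P i) (xpart y i)) (xpart w i).
Proof.
move=> Dy.
have der v i : is_derive y v (f_ P i \o (fun y => xpart y i))
                 (dotv (grad (f_ P i) (xpart y i)) (xpart v i)).
  have df := as_f_diff asm (domain_part i Dy).
  apply: (is_derive_comp_affine (v := xpart v i)).
    by move=> t; rewrite -[y]scale1r xpart_affine !scale1r.
  by rewrite -derive_grad //; exact/derivableP/diff_derivable.
have fE : fR P = \sum_(i < n) (f_ P i \o (fun y => xpart y i)).
  by apply/funext => a; rewrite fct_sumE.
have gradE v : 'D_v (fR P) y
    = \sum_i dotv (grad (f_ P i) (xpart y i)) (xpart v i).
  rewrite fE derive_sum; last by move=> i; case: (der v i).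
  by apply: eq_bigr => i _; case: (der v i).
rewrite dotv_coord; under eq_bigr do rewrite mxE gradE mulrC mulr_sumr.
rewrite exchange_big; apply: eq_bigr => i _ /=.
under eq_bigr do rewrite -dotvZr.
rewrite -dotv_sumr; congr dotv; apply/matrixP => k l; rewrite ord1 summxE.
pose J := @tagnat.Rank n (ydim P) i (lshift (pt P) k).
have sumJ m (F : 'I_m -> R) (j0 : 'I_m) : \sum_j F j * (j == j0)%:R = F j0.
  rewrite (bigD1 j0) //= big1 ?addr0 ?eqxx ?mulr1 // => j jJ.
  by rewrite (negbTE jJ) mulr0.
have -> : xpart w i k 0 = w J 0 by rewrite !mxE.
apply: (etrans _ (sumJ _ (fun c => w c 0) J)); apply: eq_bigr => c _.
by rewrite !mxE andbT eq_sym.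
Qed.

Lemma fR_lower a b : D a -> D b ->
  fR P a + dotv (grad (fR P) a) (b - a) <= fR P b.
Proof.
move=> Da Db; rewrite fR_gradE // -big_split; apply: ler_sum => i _ /=.
have df := as_f_diff asm (domain_part i Da).
rewrite xpartB -derive_grad //.
apply: (convex_derive_le (D := edom (h_ P i))); try exact: domain_part.
  exact: (convex_functionP (as_f_convex asm (i := i))).
exact: diff_derivable.
Qed.

Lemma fR_upper a b : 0 <= Lf -> D a -> D b ->
  fR P b <= fR P a + dotv (grad (fR P) a) (b - a)
            + Lf / 2 * dotv (b - a) (b - a).
Proof.
move=> Lf0 Da Db; rewrite fR_gradE //.
have L20 : 0 <= Lf / 2 by rewrite divr_ge0.
apply: le_trans (lerD (lexx _) (ler_wpM2l L20 (sum_dotv_xpart_le (b - a)))).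
rewrite mulr_sumr -!big_split; apply: ler_sum => i _ /=; rewrite xpartB.
apply: (descent_lemma (D := edom (h_ P i))); try exact: domain_part.
- exact: (convex_setP (as_dom_convex asm (i := i))).
- by move=> x Dx; exact: (as_f_diff asm Dx).
- exact: (as_f_smooth asm).
Qed.

Lemma submxcol_GR y i : submxcol (GR P y) i
  = col_mx (g_ P i (xpart y i) - tpart y i)
      (rows_if (i \in Vin P) (\sum_(j in Sin P i) gs P i j (xpart y j))).
Proof. exact: mxcolK. Qed.

Lemma GR_convex k : convex_on D (fun y => GR P y k 0).
Proof.
move=> a b t Da Db t01.
suff : lev (GR P (t *: a + (1 - t) *: b)) (t *: GR P a + (1 - t) *: GR P b).
  by move=> /(_ k); rewrite affine_coord.
apply: lev_blocks => i; rewrite submxcol_affine !submxcol_GR.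
rewrite !scale_col_mx add_col_mx rows_if_conv; apply: lev_col_mx.
  move=> r; rewrite xpart_affine tpart_affine !mxE.
  have := convex_functionP (as_g_convex asm (i := i) r)
    (domain_part i Da) (domain_part i Db) t01.
  by rewrite /=; lra.
apply: lev_rows_if => iV r; rewrite !mxE !summxE.
have cv : convex_on D (fun y => \sum_(j in Sin P i) gs P i j (xpart y j) r 0).
  apply: convex_on_sum => j jS.
  have ch := convex_functionP (as_gs_convex asm iV jS r).
  exact: (convex_on_xpart ch).
exact: cv.
Qed.

(** Each block x_j enters the sparse constraint of node i at most once, with a
   weight |S_i| coming from the Cauchy-Schwarz inequality; hence the maximum over
   j of the sum of these weights. *)
Lemma GR_lipschitz a b : 0 < Lg -> 0 < Lgs -> D a -> D b ->
  dotv (GR P a - GR P b) (GR P a - GR P b)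
  <= Lconst P Lg Lgs ^+ 2 * dotv (a - b) (a - b).
Proof.
move=> Lg0 Lgs0 Da Db; pose dx i := dotv (xpart (a - b) i) (xpart (a - b) i).
set M := (\max_(i < n) \sum_(j in Vin P | i \in Sin P j) #|Sin P j|)%N.
have -> : Lconst P Lg Lgs ^+ 2 = M%:R * Lgs ^+ 2 + (1 + Lg ^+ 2).
  rewrite addrA sqr_sqrtr //.
  by rewrite addr_ge0 ?sqr_ge0 // addr_ge0 // mulr_ge0 ?sqr_ge0 ?ler0n.
rewrite (dotv_blocks (p_ := Gdim P)).
under eq_bigr => i _ do rewrite submxcolB !submxcol_GR opp_col_mx add_col_mx
  dotv_col_mx dotv_rows_if.
rewrite big_split /= addrC mulrDl; apply: lerD; last first.
  rewrite dotv_parts mulr_sumr; apply: ler_sum => i _.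
  have -> : g_ P i (xpart a i) - tpart a i - (g_ P i (xpart b i) - tpart b i)
      = g_ P i (xpart a i) - g_ P i (xpart b i) - tpart (a - b) i.
    by rewrite tpartB !opprD !opprK addrACA.
  apply: dotv_sub_le => //; rewrite xpartB.
  by apply: lipschitz_sqr (ltW Lg0) (as_g_lip asm (i := i)) _ _;
    exact: domain_part.
rewrite -big_mkcond /=.
have sparse i : i \in Vin P ->
    dotv (\sum_(j in Sin P i) gs P i j (xpart a j)
          - \sum_(j in Sin P i) gs P i j (xpart b j))
         (\sum_(j in Sin P i) gs P i j (xpart a j)
          - \sum_(j in Sin P i) gs P i j (xpart b j))
    <= \sum_(j in Sin P i) #|Sin P i|%:R * (Lgs ^+ 2 * dx j).
  move=> iV; rewrite -sumrB; apply: le_trans (dotv_sum_le _ _) _.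
  rewrite -mulr_sumr; apply: ler_wpM2l; first exact: ler0n.
  apply: ler_sum => j jS; rewrite /dx xpartB.
  by apply: lipschitz_sqr (ltW Lgs0) (as_gs_lip asm iV jS) _ _;
    exact: domain_part.
apply: le_trans (ler_sum _ sparse) _.
rewrite (exchange_big_dep predT) //=.
have -> : M%:R * Lgs ^+ 2 * dotv (a - b) (a - b)
    = M%:R * (Lgs ^+ 2 * dotv (a - b) (a - b)) by rewrite mulrA.
have dxs : \sum_j M%:R * (Lgs ^+ 2 * dx j)
           <= M%:R * (Lgs ^+ 2 * dotv (a - b) (a - b)).
  rewrite -!mulr_sumr; apply: ler_wpM2l; first exact: ler0n.
  apply: ler_wpM2l; [exact: sqr_ge0 | exact: sum_dotv_xpart_le].
apply: le_trans dxs; apply: ler_sum => j _.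
rewrite -mulr_suml; apply: ler_wpM2r.
  by rewrite mulr_ge0 ?sqr_ge0 ?dotvv_ge0.
rewrite -natr_sum ler_nat.
exact: (leq_bigmax
  (F := fun j => \sum_(i in Vin P | j \in Sin P i) #|Sin P i|)%N).
Qed.

End Regularity.

End Reformulation.

(** * The iterates of the method *)

Section IpluxRun.
Context {R : realType} {n : nat} (P : problem R n).
Hypothesis wf : problem_wf P.
Notation yvec := 'cV[R]_(\sum_(i < n) ydim P i).

Lemma subproblem_fin W gamma lambda rho alpha (y v : nat -> yvec) u z q k a :
  edom (hR P) a ->
  iplux_subproblem W gamma lambda rho alpha (y k) (v k) (u k) (z k) (q k) a
  = (primal_model (grad (fR P)) (GR P) (BR P) (cR P) (BsR P) (csR P) W
       gamma lambda rho alpha y u z q v k a + fine (hR P a))%:E.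
Proof. by move=> Da; rewrite /iplux_subproblem (hR_fin wf). Qed.

Lemma iplux_in_domain W H gamma lambda rho alpha (y v : nat -> yvec) u z q :
  iplux P W H gamma lambda rho alpha y v u z q ->
  forall k, edom (hR P) (y k).
Proof.
move=> run; elim=> [|k IH]; first exact: (iplux_y0 run).
have := iplux_y run k (y k); rewrite [in X in (_ <= X)%E]subproblem_fin //.
rewrite /iplux_subproblem /edom /=.
by case: (hR P (y k.+1)) => //= s; rewrite ltry.
Qed.

(** The minimal value Phi y* of the Lagrangian is at most its value at a, which
   is finite. *)
Lemma multiplier_domain ystar q u v a :
  geometric_multiplier P ystar q u v -> edom (hR P) a ->
  edom (hR P) ystar.
Proof.
move=> [_ [_ /(_ a)]] + Da; rewrite /R_lagrangian (PhiR_fin wf Da).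
rewrite /PhiR /edom /=.
by case: (hR P ystar) => [s _||] /=; rewrite ?ltry ?ltNyr.
Qed.

Lemma multiplier_saddle ystar q u v a :
  geometric_multiplier P ystar q u v -> edom (hR P) ystar -> edom (hR P) a ->
  fR P ystar + fine (hR P ystar) <= fR P a + fine (hR P a)
    + (dotv q (GR P a) + dotv u (coupling P a) + dotv v (BsR P *m a - csR P)).
Proof.
move=> [_ [_ /(_ a)]] + Ds Da.
by rewrite /R_lagrangian !(PhiR_fin wf) // -EFinD lee_fin.
Qed.

End IpluxRun.

Theorem theorem1 (R : realType) (n : nat) (P : problem R n) (e : rel 'I_n)
    (PW PH : 'M[R]_n)
    (gamma lambda rho alpha alpha1 alpha2 alpha3 Lf Lg Lgs : R)
    (y v : nat -> 'cV[R]_(\sum_(i < n) ydim P i))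
    (u z : nat -> 'cV[R]_(\sum_(i < n) (mt P + pt P)))
    (q : nat -> 'cV[R]_(\sum_(i < n) Gdim P i))
    (ystar : 'cV[R]_(\sum_(i < n) ydim P i))
    (qstar : 'cV[R]_(\sum_(i < n) Gdim P i))
    (ustar : 'cV[R]_(mt P + pt P))
    (vstar : 'cV[R]_(\sum_(i < n) sdim P i)) :
  let W := kron_id PW (mt P + pt P) in
  let H := kron_id PH (mt P + pt P) in
  let Bs := BsR P in
  let Md := mpinv (Bs^T *m Bs) in
  let L := Lconst P Lg Lgs in
  let zstar := BR P *m ystar - cR P in
  let G := GR P in
  let Phi := PhiR P in
  let ybar := running_average y in
  problem_wf P ->
  admissible_graph P e ->
  0 < gamma -> 0 < lambda -> 0 < rho ->
  0 < alpha1 -> 0 < alpha2 -> 0 < alpha3 ->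
  alpha = alpha1 + alpha2 + alpha3 ->
  mixing_matrices e PW PH ->
  0 < Lf -> 0 < Lg -> 0 < Lgs ->
  problem_assumption P Lf Lg Lgs ->
  Lf + L ^+ 2 <= alpha ->
  spectral_norm Bs <= lambda ->
  iplux P W H gamma lambda rho alpha y v u z q ->
  R_optimal P ystar ->
  geometric_multiplier P ystar qstar ustar vstar ->
  let sn := Num.sqrt n%:R in
  let R0 :=
    (2 * rho)^-1 * wnorm (mpinv H) (z 0%N - zstar) ^+ 2
    + rho / 2 * wnorm W (u 0%N) ^+ 2
    + (2 * gamma)^-1 * wnorm Md (v 0%N) ^+ 2
    + (gamma * lambda ^+ 2 + alpha) / 2 * enorm (y 0%N - ystar) ^+ 2
    + 2^-1 * enorm (q 0%N) ^+ 2 - 2^-1 * enorm (G (y 0%N)) ^+ 2 in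
  let C :=
    R0 + rho * sn * enorm ustar * wnorm W (u 0%N)
    + gamma^-1 * enorm vstar * wnorm Md (v 0%N)
    + rho * n%:R / 2 * enorm ustar ^+ 2
    + (2 * gamma)^-1 * enorm vstar ^+ 2
    + enorm qstar ^+ 2 + 2^-1 * enorm (G ystar) ^+ 2 in
  let Vq := 2 * (enorm qstar + Num.sqrt C) in
  let Vu := sn * (wnorm W (u 0%N) + sn * enorm ustar
                  + Num.sqrt (2 * C / rho)) in
  let Vv := wnorm Md (v 0%N) + enorm vstar + Num.sqrt (2 * gamma * C) in
  let RPhi := Vq * dotv (const_mx 1) qstar + rho * Vu * enorm ustar
              + Vv * enorm vstar / gamma in
  let RPhi' := R0 in
  [/\ 0 <= Vq, 0 <= Vu, 0 <= Vv, 0 <= RPhi & 0 <= RPhi'] /\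
  forall k : nat, (1 <= k)%N ->
    [/\ lev (G (ybar k)) (const_mx (Vq / k%:R)),
        enorm (coupling P (ybar k)) <= rho * Vu / k%:R,
        enorm (Bs *m ybar k - csR P) <= Vv / (gamma * k%:R),
        ((- (RPhi / k%:R))%:E <= Phi (ybar k) - Phi ystar)%E &
        (Phi (ybar k) - Phi ystar <= (RPhi' / k%:R)%:E)%E].
Proof.
move=> W H Bs Md L zstar G Phi ybar wf _ g0 l0 r0 _ _ _ _ mix Lf0 Lg0 Lgs0 asm.
move=> alpha_ge Bs_le run opt mult sn R0 C Vq Vu Vv RPhi RPhi'.
have [feasG feasU feasV] := proj1 opt.
have y_dom := iplux_in_domain wf run.
have s_dom := multiplier_domain wf mult (y_dom 0%N).
pose S : 'M[R]_(_, _) := ones_kron_id n (mt P + pt P).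
have W_psd : psdmx W by apply/psdmx_kron/(mm_PW_psd mix).
have H_psd : psdmx H by apply/psdmx_kron/(mm_PH_psd mix).
have WH_le1 : psdmx (1%:M - (W + H)).
  by rewrite kron_id_gap; apply/psdmx_kron/(mm_sum mix).
have W_S : W *m S = S.
  by rewrite (kron_ones (a := 1)) ?scale1r // (mm_PW_ones mix).
have H_S : H *m S = 0.
  rewrite (kron_ones (a := 0)) ?scale0r //; apply/(mm_PH_null mix).
  by exists 1; rewrite scale1r.
have H_null (w : 'cV_(\sum_(i < n) (mt P + pt P))) :
    H *m w = 0 -> exists a : 'cV_(mt P + pt P), w = S *m a.
  by apply: kron_null => w'; apply: (proj1 (mm_PH_null mix w')).
(* z (0) = rho H u (0) and z* are orthogonal to the range of S, so z (0) - z*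
   lies in the range of H. *)
pose e0 := mpinv H *m (z 0%N - zstar).
have He0 : H *m e0 = z 0%N - zstar.
  apply: (mpinv_range (proj1 H_psd) H_null).
  rewrite mulmxBr -/(coupling P ystar) feasU subr0 (iplux_z0 run) -scalemxAr.
  by rewrite mulmxA -(proj1 H_psd) -trmx_mul H_S trmx0 mul0mx scaler0.
have [v0E w0E] := gram_mpinv (iplux_v0 run).
set w0 := Bs *m (Md *m v 0%N) in v0E w0E.
have z0E : z 0%N = BR P *m ystar - cR P + H *m e0 by rewrite He0 addrC subrK.
have Bs_bound (a : 'cV_(\sum_(i < n) ydim P i)) :
    dotv (Bs *m a) (Bs *m a) <= lambda ^+ 2 * dotv a a.
  rewrite -!sqr_enorm -exprMn ler_sqr ?nnegrE ?mulr_ge0 ?enorm_ge0 ?(ltW l0) //.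
  apply: le_trans (spectral_normP _ _) _.
  by apply: ler_wpM2r => //; exact: enorm_ge0.
have y_step k a : edom (hR P) a ->
    primal_model (grad (fR P)) G (BR P) (cR P) Bs (csR P) W gamma lambda rho
      alpha y u z q v k (y k.+1) + fine (hR P (y k.+1))
    <= primal_model (grad (fR P)) G (BR P) (cR P) Bs (csR P) W gamma lambda rho
      alpha y u z q v k a + fine (hR P a).
  move=> Da; have := iplux_y run k a.
  by rewrite !(subproblem_fin wf) // lee_fin.
have R0E : R0 = lyapunov G Bs (csR P) W H gamma lambda rho alpha y u q ystar w0
                  e0 0%N.
  rewrite /lyapunov null_offset0 range_dual0 /R0 !sqr_enorm.
  rewrite (wnorm_mpinv H_psd He0) (sqr_wnorm _ W_psd) -w0E sqr_enorm.
  by [].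
have rates := ergodic_rates (domain_conv wf asm) (hR_convex wf asm)
  (fR_lower wf asm) (fun a b => fR_upper wf asm (ltW Lf0)) (GR_convex wf asm)
  (fun a b => GR_lipschitz wf asm Lg0 Lgs0) Bs_bound g0 l0 r0 (ltW Lf0) alpha_ge
  W_psd H_psd WH_le1 y_dom y_step (iplux_v run) (iplux_u run) (iplux_z run)
  (iplux_q0 run) (iplux_q run) s_dom feasG feasV (esym v0E) z0E
  (fR_convex wf asm) W_S H_S (ler0n R n) (@ones_kron_sqr R n _) feasU
  (proj1 mult) (fun a => multiplier_saddle wf mult s_dom).
move: rates; rewrite /rate_lower /rate_q /rate_u /rate_v /rate_const -R0E w0E.
case=> ge0 rates; split=> [|[//|k] _]; first exact: ge0.
have [Dk rG rU rV /andP[lo up]] := rates k; split; try by [].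
- by rewrite /Phi !(PhiR_fin wf) // -EFinB lee_fin; exact: lo.
- by rewrite /Phi !(PhiR_fin wf) // -EFinB lee_fin; exact: up.
Qed.
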